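(* Assume $T$ is NIP, $A$ is a $\downarrow^f$-extension base, and $\downarrow^f$ is left totally trivial over $A$. Then the following are equivalent for an (infinite) $A$-indiscernible sequence $\langle a_i:i\in I\rangle$: (1) $\langle a_i:i\in I\rangle$ is a witness over $A$, i.e. whenever $i\in I$ and a formula $\varphi(x,a_i)\in L(Aa_i)$ divides over $A$, the set $\{\varphi(x,a_j):j\in I\}$ is inconsistent; (2) $a_{\neq i}\downarrow^f_A a_i$ for all $i\in I$, where $a_{\neq i}=(a_j:j\in I, j\neq i)$; (3) $a_i\downarrow^f_A a_j$ for all $i\neq j\in I$; (4) $\{a_i:i\in I\}$ is strictly independent over $A$.
   Context: $T$ is a complete first-order theory in a language $L$ and $\mathbb{M}\models T$ is a sufficiently saturated and homogeneous monster model; ''small'' means of size less than the saturation of $\mathbb{M}$. Tuples are small tuples of elements of $\mathbb{M}$, parameter sets and index sets are small, and juxtaposition denotes concatenation / union. A formula $\varphi(x,b)$ with parameters in $\mathbb{M}$ divides over a small set $A$ if there is an $A$-indiscernible sequence $(b_i)_{i\in\omega}$ with $b_i\equiv_A b$ such that $\{\varphi(x,b_i):i\in\omega\}$ is inconsistent. It forks over $A$ if it implies a finite disjunction of formulas (with parameters in $\mathbb{M}$), each dividing over $A$. A partial type forks over $A$ if it implies a formula which forks over $A$. Write $a\downarrow^f_A b$ if $\operatorname{tp}(a/Ab)$ does not fork over $A$. A small set $A$ is a $\downarrow^f$-extension base if $a\downarrow^f_A A$ for all tuples $a$. The relation $\downarrow^f$ is left totally trivial over $A$ if for all tuples $\bar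 a,\bar b,\bar c$, $\bar a\downarrow^f_A\bar c$ and $\bar b\downarrow^f_A\bar c$ imply $\bar a\bar b\downarrow^f_A\bar c$. Sequences $(I_i:i\in S)$ are mutually indiscernible over $A$ if each $I_i$ is indiscernible over $A\cup\bigcup_{j\neq i}I_j$. A set (indexed family) of tuples $\{b_i:i\in S\}$ is strictly independent over $A$ if for any (infinite) $A$-indiscernible sequences $I_i$ such that $b_i$ is an element of $I_i$ for all $i\in S$, there exist sequences $I_i'\equiv_{Ab_i}I_i$ such that $(I_i':i\in S)$ are mutually indiscernible over $A$. *)

(* Defs.v *)
From mathcomp Require Import all_boot all_order.
From mathcomp Require Import boolp classical_sets functions cardinality.

Set Implicit Arguments.
Unset Strict Implicit.
Unset Printing Implicit Defensive.

Local Open Scope classical_set_scope.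
Local Open Scope card_scope.

Record language : Type := Language {
  fun_sym : Type; fun_ar : fun_sym -> nat;
  rel_sym : Type; rel_ar : rel_sym -> nat }.

Inductive term (L : language) (V : Type) : Type :=
| Var of V
| App (f : fun_sym L) of ('I_(fun_ar f) -> term L V).
Arguments Var {L V}.
Arguments App {L V}.

(* First-order formulas with equality and free variables in [V]; in [All phi]
   the bound variable is [None].  The other connectives are classically
   definable. *)
Inductive formula (L : language) (V : Type) : Type :=
| Bot
| Equal of term L V & term L V
| Relation (r : rel_sym L) of ('I_(rel_ar r) -> term L V)
| Imp of formula L V & formula L V
| All of formula L (option V).
Arguments Bot {L V}.
Arguments Equal {L V}.
Arguments Relation {L V}.
Arguments Imp {L V}.
Arguments All {L V}.

Definition Not (L : language) (V : Type) (phi : formula L V) := Imp phi Bot.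

Record structure (L : language) : Type := Structure {
  carrier :> Type;
  carrier_inhabited : inhabited carrier;
  fun_int : forall f : fun_sym L, ('I_(fun_ar f) -> carrier) -> carrier;
  rel_int : forall r : rel_sym L, ('I_(rel_ar r) -> carrier) -> Prop }.
Arguments fun_int {L} s f.
Arguments rel_int {L} s r.

Fixpoint eval (L : language) (M : structure L) (V : Type) (e : V -> M)
    (t : term L V) : M :=
  match t with
  | Var v => e v
  | App f ts => fun_int M f (fun i => eval e (ts i))
  end.

Fixpoint sat (L : language) (M : structure L) (V : Type) (e : V -> M)
    (phi : formula L V) : Prop :=
  match phi with
  | Bot => False
  | Equal s t => eval e s = eval e t
  | Relation r ts => rel_int M r (fun i => eval e (ts i))
  | Imp phi psi => sat e phi -> sat e psi
  | All phi => forall m : M, sat (fun v => oapp e m v) phi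
  end.

Definition theory (L : language) := set (formula L void).

Definition holds (L : language) (M : structure L) (s : formula L void) :=
  sat (of_void M) s.

Definition models (L : language) (M : structure L) (T : theory L) :=
  forall s, T s -> holds M s.

Definition entails (L : language) (T : theory L) (s : formula L void) :=
  forall N : structure L, models N T -> holds N s.

Definition complete (L : language) (T : theory L) : Prop :=
  (exists N : structure L, models N T) /\
  (forall s, entails T s \/ entails T (Not s)).

(* A cardinal kappa is given by a type [K] of that cardinality. *)
Definition small_set (K U : Type) (A : set U) : Prop := ~ ([set: K] #<= A).

Definition small (K X : Type) : Prop := small_set K [set: X].

Definition tcat (U X Y : Type) (a : X -> U) (b : Y -> U) : X + Y -> U :=
  fun v => match v with inl x => a x | inr y => b y end.

Definition concat (U S : Type) (X : S -> Type) (a : forall s, X s -> U) :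
  {s : S & X s} -> U := fun p => a (tag p) (tagged p).

(* A formula in the variables [X] with a finite tuple of parameters from [M]. *)
Record pformula (L : language) (M : structure L) (X : Type) : Type := PFormula {
  par_nb : nat;
  pform : formula L (X + 'I_par_nb);
  par : 'I_par_nb -> M }.
Arguments PFormula {L M X}.
Arguments pform {L M X} p.
Arguments par {L M X} p i.

Section Model.
Variables (L : language) (M : structure L).

Definition psat (X : Type) (a : X -> M) (phi : pformula M X) : Prop :=
  sat (tcat a (par phi)) (pform phi).

Definition formulas_over (B : set M) (X : Type) : set (pformula M X) :=
  [set phi | range (par phi) `<=` B].

Definition tp (X : Type) (a : X -> M) (B : set M) : set (pformula M X) :=
  [set phi | formulas_over B phi /\ psat a phi].

Definition eqtp (A : set M) (X : Type) (a b : X -> M) : Prop :=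
  tp a A = tp b A.

Definition realizes (X : Type) (a : X -> M) (p : set (pformula M X)) : Prop :=
  forall phi, p phi -> psat a phi.

Definition finitely_satisfiable (X : Type) (p : set (pformula M X)) : Prop :=
  forall (n : nat) (phi : 'I_n -> pformula M X), (forall i, p (phi i)) ->
    exists a : X -> M, forall i, psat a (phi i).

Definition saturated (K : Type) : Prop :=
  forall (B : set M) (p : set (pformula M unit)),
    small_set K B -> p `<=` @formulas_over B unit -> finitely_satisfiable p ->
    exists a : unit -> M, realizes a p.

Definition automorphism (s : M -> M) : Prop :=
  [/\ bijective s,
      forall f (t : 'I_(fun_ar f) -> M),
        s (fun_int M f t) = fun_int M f (fun i => s (t i))
    & forall r (t : 'I_(rel_ar r) -> M),
        rel_int M r (fun i => s (t i)) <-> rel_int M r t].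

Definition strongly_homogeneous (K : Type) : Prop :=
  forall (X : Type) (a b : X -> M), small K X -> eqtp set0 a b ->
    exists2 s : M -> M, automorphism s & forall x, s (a x) = b x.

(* kappa-saturated and strongly kappa-homogeneous, for an uncountable strong
   limit cardinal kappa > |L|. *)
Definition monster (K : Type) : Prop :=
  [/\ small K nat,
      forall X : Type, small K X -> small K (set X),
      small K (fun_sym L + rel_sym L),
      saturated K
    & strongly_homogeneous K].

Definition indiscernible (A : set M) d (I : orderType d) (X : Type)
    (a : I -> X -> M) : Prop :=
  forall (n : nat) (i j : 'I_n -> I),
    {homo i : p q / (p < q)%N >-> (p < q)%O} ->
    {homo j : p q / (p < q)%N >-> (p < q)%O} ->
    eqtp A (concat (fun p => a (i p))) (concat (fun p => a (j p))).

Definition mutually_indiscernible (A : set M) d (S : Type)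
    (J : S -> orderType d) (X : S -> Type) (c : forall s, J s -> X s -> M) :
    Prop :=
  forall s : S,
    indiscernible (A `|` \bigcup_(t in [set t | t <> s]) range (concat (c t)))
      (c s).

(* Sets of formulas with small parameter set and few variables are consistent
   iff they are realized in the monster model; inconsistency and implication
   are accordingly read in [M]. *)
Definition inconsistent (I X Y : Type) (phi : formula L (X + Y))
    (b : I -> Y -> M) : Prop :=
  ~ exists a : X -> M, forall i, sat (tcat a (b i)) phi.

Definition divides (A : set M) (X Y : Type) (phi : formula L (X + Y))
    (b : Y -> M) : Prop :=
  exists c : nat -> Y -> M,
    [/\ indiscernible A c, forall i, eqtp A (c i) b & inconsistent phi c].

Definition forks (A : set M) (X : Type) (phi : pformula M X) : Prop :=
  exists (k : nat) (psi : 'I_k -> pformula M X),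
    (forall i, divides A (pform (psi i)) (par (psi i))) /\
    (forall a : X -> M, psat a phi -> exists i, psat a (psi i)).

Definition type_forks (A : set M) (X : Type) (p : set (pformula M X)) : Prop :=
  exists phi : pformula M X,
    (forall a : X -> M, realizes a p -> psat a phi) /\ forks A phi.

(* [nonforking A a B] is a \downarrow^f_A B; a tuple b on the right-hand side
   is passed as the set [range b] of its elements. *)
Definition nonforking (A : set M) (X : Type) (a : X -> M) (B : set M) : Prop :=
  ~ type_forks A (tp a (A `|` B)).

Definition extension_base (K : Type) (A : set M) : Prop :=
  forall (X : Type) (a : X -> M), small K X -> nonforking A a A.

Definition left_totally_trivial (K : Type) (A : set M) : Prop :=
  forall (X Y Z : Type) (a : X -> M) (b : Y -> M) (c : Z -> M),
    small K X -> small K Y -> small K Z ->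
    nonforking A a (range c) -> nonforking A b (range c) ->
    nonforking A (tcat a b) (range c).

(* [phi] is evaluated at (x, e, a_i), with e a finite tuple in [A], so that
   phi(x, e, a_i) ranges over the formulas of L(A a_i). *)
Definition witness (A : set M) (I X : Type) (a : I -> X -> M) : Prop :=
  forall (i : I) (n m : nat) (phi : formula L ('I_n + ('I_m + X)))
      (e : 'I_m -> M),
    range e `<=` A -> divides A phi (tcat e (a i)) ->
    inconsistent phi (fun j => tcat e (a j)).

Definition strictly_independent (K : Type) (A : set M) (S : Type)
    (X : S -> Type) (b : forall s, X s -> M) : Prop :=
  forall d (J : S -> orderType d) (c : forall s, J s -> X s -> M),
    (forall s, small K (J s)) -> (forall s, infinite_set [set: J s]) ->
    (forall s, indiscernible A (c s)) ->
    (forall s, exists j, c s j =1 b s) ->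
    exists c' : forall s, J s -> X s -> M,
      (forall s, eqtp (A `|` range (b s)) (concat (c' s)) (concat (c s))) /\
      mutually_indiscernible A c'.

(* The independence property: some phi(x, y) shatters an infinite sequence. *)
Definition has_IP (n m : nat) (phi : formula L ('I_n + 'I_m)) : Prop :=
  exists (a : nat -> 'I_n -> M) (b : set nat -> 'I_m -> M),
    forall (i : nat) (s : set nat), sat (tcat (a i) (b s)) phi <-> s i.

Definition NIP : Prop :=
  forall (n m : nat) (phi : formula L ('I_n + 'I_m)), ~ has_IP phi.

End Model.

(* Main.v *)
From Stdlib Require Import Inverse_Image.
Require Import Defs.
From mathcomp Require Import all_boot all_order.
From mathcomp Require Import boolp classical_sets functions cardinality.
From mathcomp Require Import filter wochoice.

(** In the monster model everything is phrased with definable sets of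
    assignments and with automorphisms that fix [A]; formulas occur only where
    the notions at hand are translated into these terms.

    Left total triviality says that a tuple is free from (does not fork with) [c]
    over [A] as soon as each of its entries is ([nonforking_entries]). So the free
    sets of parameters that appear in the arguments below can be joined on the left
    without any transitivity argument, and conditions (2) and (3) amount to the
    same.

    (3) implies (4). Given sequences [I_i] through [a_i], replace them one at a
    time by conjugates over [a_i] that are indiscernible over the rows found so far
    and the other [a_j] ([indiscernible_over]). This is possible because those rows
    consist of conjugates over [a_i] of the [a_j], which are free from [a_i]. In the
    resulting array every choice of one term in each row has the type of [(a_i)]
    over [A]; an indiscernible sequence extracted from the columns, stretched to the
    ordered sum of the index sets, yields mutually indiscernible rows
    ([mutual_rows]).

    (4) implies (1). If [phi(x, a_i)] divides, let the [I_i] witness dividing and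
    make them mutually indiscernible. A point that satisfies every [phi(x, a_j)]
    fails [phi] at some term of each row; since all choices of terms look alike,
    this shatters the sequence, against NIP ([nip_alternation],
    [strictly_independent_dividing]).

    (1) implies (3). Let [phi(a_j, a_i)] be a formula that forks over [A]. If it
    divides, it is inconsistent along the sequence by (1); but [a_j]
    satisfies it along new terms inserted at [a_i], as many as desired
    ([witness_free]). What remains is that forking implies dividing
    ([forking_dividing]). A formula that forks implies a disjunction of dividing
    formulas over a common parameter [b]; if some sequence that starts in the type
    of [b] satisfies (3), then by (3) => (4) => (1) each disjunct, hence the
    disjunction, is inconsistent along it.

    Such a sequence is built from conjugates [b'] of [b] that are free from a given
    tuple [c] and from which [c] is free ([strict_extension]). They exist because a
    formula that forks over [A] has a small family of conjugates that is
    jointly inconsistent ([forking_conjugates]). This is the broom lemma of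
    Chernikov and Kaplan, whose proof becomes an induction on the number of dividing
    formulas. It relies on dividing being witnessed by sequences in which each term
    is free from the earlier ones ([free_dividing]): these come from an array whose
    rows witness dividing and are free from the earlier rows, because under NIP a
    free tuple cannot distinguish the terms of an indiscernible sequence
    ([nonforking_constant]). *)

Set Implicit Arguments.
Unset Strict Implicit.
Unset Printing Implicit Defensive.

Import Order.TTheory.

Local Open Scope classical_set_scope.

(** * Small types *)

Lemma dependent_choice I (T : I -> Type) (P : forall i, T i -> Prop) :
  (forall i, exists x, P i x) -> exists f : forall i, T i, forall i, P i (f i).
Proof.
by move=> h; exists (fun i => sval (cid (h i))) => i; exact: svalP.
Qed.

Definition injects (X Y : Type) : Prop := exists f : X -> Y, injective f.

Lemma injects_refl X : injects X X.
Proof. by exists id. Qed.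

Lemma injects_trans X Y Z : injects X Y -> injects Y Z -> injects X Z.
Proof. by move=> [f fI] [g gI]; exists (g \o f); apply: inj_comp. Qed.

Lemma sval_inj T (P : T -> Prop) : injective (@proj1_sig T P).
Proof. by move=> [x p] [y q] /= e; subst y; congr exist; exact: Prop_irrelevance. Qed.

Lemma injects_sub T (P Q : T -> Prop) :
  (forall x, P x -> Q x) -> injects {x | P x} {x | Q x}.
Proof.
move=> PQ; exists (fun u => exist Q (sval u) (PQ _ (svalP u))).
by move=> u v [] /sval_inj.
Qed.

Lemma injects_surj X Y (f : X -> Y) : (forall y, exists x, f x = y) -> injects Y X.
Proof.
move=> /choice[g gK]; exists g => y y' e.
by rewrite -(gK y) -(gK y') e.
Qed.

Lemma injects_setP X Y (B : set Y) :
  ([set: X] #<= B)%card <-> injects X {y | B y}.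
Proof.
split=> [/card_leP[f]|[f fI]].
- pose s (x : X) : [set: X] := SigSub (mem_set (I : [set: X] x)).
  have fB x : B (val (f (s x))) by apply: set_mem (valP (f _)).
  exists (fun x => exist _ _ (fB x)) => x y [] /val_inj e.
  by have [] := @inj _ _ _ f _ _ (in_setT (s x)) (in_setT (s y)) e.
- have gI : {in [set: X] &, injective (fun x => sval (f x))}.
    by move=> x y _ _ /sval_inj/fI.
  apply: (@card_le_trans _ _ _ ((fun x => sval (f x)) @` [set: X])).
    by have := inj_card_eq gI; rewrite card_eq_le => /andP[].
  by apply: subset_card_le => _ [x _ <-]; exact: svalP.
Qed.

Lemma small_setP K U (A : set U) : small_set K A <-> ~ injects K {x | A x}.
Proof. by rewrite /small_set injects_setP. Qed.

Lemma injects_full X : injects {x : X | [set: X] x} X /\ injects X {x : X | [set: X] x}.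
Proof.
split; first by exists sval; exact: sval_inj.
by exists (fun x => exist _ x I) => x y [].
Qed.

Lemma smallP K X : small K X <-> ~ injects K X.
Proof.
rewrite /small small_setP; have [f g] := injects_full X.
by split=> h /injects_trans j; apply: h; apply: j.
Qed.

Lemma small_set_typeP K U (A : set U) : small_set K A <-> small K {x | A x}.
Proof. by rewrite small_setP smallP. Qed.

Lemma small_sub K X Y : injects X Y -> small K Y -> small K X.
Proof. by move=> XY /smallP h; apply/smallP => j; apply/h/(injects_trans j). Qed.

Definition wellorder X (R : X -> X -> Prop) : Prop :=
  well_founded R /\ forall x y, x = y \/ R x y \/ R y x.

(** A failure would give a cycle. *)
Lemma wellorder_trans X (R : X -> X -> Prop) : wellorder R ->
  forall x y z, R x y -> R y z -> R x z.
Proof.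
move=> [wf tot] x y z xy yz.
have [e|[//|zx]] := tot x z; exfalso.
- have H w : w = x \/ w = y -> False; last by apply: (H x); left.
  elim: {w}(wf w) => w _ IH [ew|ew]; rewrite ew in IH.
  + by apply: (IH y); [rewrite e|right].
  + by apply: (IH x); [|left].
- have H w : w = x \/ w = y \/ w = z -> False; last by apply: (H x); left.
  elim: {w}(wf w) => w _ IH [ew|[ew|ew]]; rewrite ew in IH.
  + by apply: (IH z) => //; right; right.
  + by apply: (IH x) => //; left.
  + by apply: (IH y) => //; right; left.
Qed.

Lemma exists_wellorder X : exists R : X -> X -> Prop, wellorder R.
Proof.
have [R woR] := well_ordering_principle {classic X}.
have wo2 (x y : X) : R x y \/ R y x.
  have [|z [[]]] := woR (pred2 (x : {classic X}) y); first by exists x; rewrite !inE eqxx.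
  rewrite !inE => zxy zmin _.
  by case/orP: zxy => /eqP <-; [left|right]; apply: zmin; rewrite !inE eqxx ?orbT.
have anti (x y : X) : R x y -> R y x -> x = y.
  move=> xy yx; have Rxx (z : X) : R z z by case: (wo2 z z).
  have [|z [_ zu]] := woR (pred2 (x : {classic X}) y); first by exists x; rewrite !inE eqxx.
  have m (w : X) : w = x \/ w = y -> R w x -> R w y -> z = w.
    move=> hw wx wy; apply: zu; split.
      by rewrite !inE; case: hw => ->; rewrite eqxx ?orbT.
    by move=> t; rewrite !inE => /orP[] /eqP ->.
  have e1 : z = x by apply: m; auto.
  have e2 : z = y by apply: m; auto.
  by rewrite -e1 -e2.
exists (fun x y => R x y /\ x <> y); split; last first.
  move=> x y; have [->|xy] := pselect (x = y); first by left.
  by right; case: (wo2 x y) => h; [left|right]; split=> // /esym.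
move=> x; apply: contrapT => nx.
pose B : {pred {classic X}} :=
  fun x => `[< ~ Acc (fun x y => R x y /\ x <> y) x >].
have [|z [[/asboolP zB zmin] _]] := woR B; first by exists x; apply/asboolP.
apply: zB; constructor=> y [Ryz yz]; apply: contrapT => ny; apply: yz.
by apply: anti => //; apply: zmin; apply/asboolP.
Qed.

(** Transfinite recursion: each value avoids the earlier ones, which cannot
    exhaust the target as long as the initial segments are too small. *)
Lemma wellorder_injects X (R : X -> X -> Prop) Z : wellorder R ->
  (forall x, ~ injects Z {y | R y x}) -> injects X Z.
Proof.
move=> [wf tot] h.
have step x (r : forall y, R y x -> Z) : {z | forall y p, r y p <> z}.
  apply: cid; apply: contrapT => nz; apply: (h x).
  apply: (@injects_surj _ _ (fun u : {y | R y x} => r (sval u) (proj2_sig u))) => z.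
  apply: contrapT => nu; apply: nz; exists z => y p e; apply: nu.
  by exists (exist _ y p).
pose G x r := sval (step x r).
pose f := Fix wf (fun=> Z) G.
have fE x : f x = G x (fun y _ => f y).
  rewrite /f Fix_eq // => y g g' gg'; congr G.
  by apply: functional_extensionality_dep => z; apply: funext => p.
have neq x y : R y x -> f y <> f x.
  rewrite (fE x) => p; exact: (svalP (step x (fun y _ => f y)) _ p).
exists f => x y e; have [//|[] p] := tot x y; first by case: (neq _ _ p).
by case: (neq _ _ p).
Qed.

(** Recursion along a well-order of [X] either embeds [X] or gets stuck at an
    initial segment into which [Y] embeds. *)
Lemma injects_total X Y : injects X Y \/ injects Y X.
Proof.
have [R woR] := exists_wellorder X.
have [h|h] := pselect (forall x, ~ injects Y {y | R y x}).
  by left; exact: wellorder_injects woR h.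
right; have [x /contrapT] := (existsNP _).2 h.
by move=> /injects_trans; apply; exists sval; exact: sval_inj.
Qed.

Lemma small_injects K X : small K X -> injects X K.
Proof. by move=> /smallP; case: (injects_total K X). Qed.

Definition small_wellorder K X (R : X -> X -> Prop) : Prop :=
  wellorder R /\ forall x, small K {y | R y x}.

(** Cutting a well-order of [K] at the first initial segment that has the size
    of [K] leaves an order of initial type. *)
Lemma exists_small_wellorder K X : injects X K ->
  exists R : X -> X -> Prop, small_wellorder K R.
Proof.
have pull Y Z (R : Z -> Z -> Prop) (f : Y -> Z) : injective f -> wellorder R ->
    (forall y, small K {z | R z (f y)}) ->
    exists R' : Y -> Y -> Prop, small_wellorder K R'.
  move=> fI [wf tot] sm; exists (fun x y => R (f x) (f y)); split; first split.
  - exact: wf_inverse_image.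
  - by move=> x y; have [/fI->|] := tot (f x) (f y); [left|right].
  - move=> y; apply: small_sub (sm y).
    exists (fun u : {x | R (f x) (f y)} => exist (fun z => R z (f y)) (f (sval u)) (svalP u)).
    by move=> u v [] /fI /sval_inj.
move=> [g gI]; have [R woR] := exists_wellorder K.
have [h|h] := pselect (forall x, small K {y | R y x}).
  by apply: (pull _ _ R g) => // y.
pose B z := ~ small K {y | R y z}.
have [z zB zmin] : exists2 z, B z & forall y, R y z -> small K {x | R x y}.
  have [x xB] := (existsNP _).2 h; apply: contrapT => nz.
  apply: xB; elim: {x}(woR.1 x) => x _ IH; apply: contrapT => xB; apply: nz.
  by exists x.
have [f fI] : injects K {y | R y z} by apply: contrapT => /smallP.
apply: (pull _ _ R (fun x => sval (f (g x)))) => //.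
  by move=> x y /sval_inj/fI/gI.
by move=> y; apply: zmin; exact: (svalP (f (g y))).
Qed.

Section Small.
Variable K : Type.
Hypothesis K_nat : small K nat.
Hypothesis K_lim : forall X, small K X -> small K (set X).

Lemma small_finite X : (exists n, injects X 'I_n) -> small K X.
Proof.
move=> [n j]; apply: small_sub K_nat; apply: injects_trans j _.
by exists (@nat_of_ord n); exact: val_inj.
Qed.

Lemma small_finType (F : finType) : small K F.
Proof. by apply: small_finite; exists #|F|, enum_rank; exact: enum_rank_inj. Qed.

Lemma small_void : small K void. Proof. exact: small_finType. Qed.
Lemma small_unit : small K unit. Proof. exact: small_finType. Qed.
Lemma small_ord n : small K 'I_n. Proof. exact: small_finType. Qed.

(** Unless the sum is finite, the power set of the larger summand has room for
    both: singletons for one of them, complements of singletons for the other. *)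
Lemma small_sum X Y : small K X -> small K Y -> small K (X + Y).
Proof.
wlog XY : X Y / injects X Y => [th sX sY|sX sY].
  have [j|j] := injects_total X Y; first exact: th.
  apply: (@small_sub _ _ (Y + X)); last exact: th.
  exists (fun u => match u with inl x => inr x | inr y => inl y end).
  by move=> [x|y] [x'|y'] // [->].
have [[n j]|nfin] := pselect (exists n, injects Y 'I_n).
  apply: small_finite; exists #|{: 'I_n + 'I_n}|.
  have [f fI] := j; have [g gI] := injects_trans XY j.
  exists (fun u => enum_rank (match u with inl x => inl (g x) | inr y => inr (f y) end)).
  by move=> [x|y] [x'|y'] /enum_rank_inj // [] => [/gI->|/fI->].
apply: small_sub (K_lim sY); have [g gI] := XY.
have neq (y y' : Y) : [set y] <> ~` [set y'].
  move=> e; apply: nfin; exists 2%N.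
  have h z : z = y \/ z = y'.
    have [->|zy] := pselect (z = y'); first by right.
    by left; have : (~` [set y']) z by []; rewrite -e.
  exists (fun z => if pselect (z = y) then ord0 else lift ord0 ord0) => z z'.
  case: (pselect (z = y)) => [ez|zy]; case: (pselect (z' = y)) => [ez'|zy'] // _.
    by rewrite ez ez'.
  by have [//|->] := h z; have [//|->] := h z'.
exists (fun u => match u with inl x => [set g x] | inr y => ~` [set y] end).
move=> [x|y] [x'|y'] // e.
- have h : [set g x'] (g x) by rewrite -e.
  by rewrite (gI _ _ h).
- by have := neq _ _ e.
- by have := neq _ _ (esym e).
- move: (congr1 (@setC _) e); rewrite !setCK => e'.
  have h : [set y'] y by rewrite -e'.
  by rewrite h.
Qed.

Lemma small_prod X Y : small K X -> small K Y -> small K (X * Y).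
Proof.
move=> sX sY; apply: small_sub (K_lim (small_sum sX sY)).
exists (fun p => [set u | u = inl p.1 \/ u = inr p.2]) => -[x y] [x' y'] e.
have : [set u | u = inl x' \/ u = inr y'] (inl x) by rewrite -e; left.
have : [set u | u = inl x' \/ u = inr y'] (inr y) by rewrite -e; right.
by move=> [//|[->]] [[->]|].
Qed.

Lemma small_tagged S X : small K S -> small K X -> small K {s : S & X}.
Proof.
move=> sS sX; apply: small_sub (small_prod sS sX).
by exists (fun u => (tag u, tagged u)) => -[s x] [t y] [-> ->].
Qed.

Lemma tag_injects S (X : S -> Type) n :
  (forall s, injects (X s) n) -> injects {s & X s} (S * n).
Proof.
move=> /dependent_choice[f fI]; exists (fun u => (tag u, f _ (tagged u))).
by move=> [s x] [t y] /= [e]; subst t => /fI ->.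
Qed.

(** Order the product lexicographically, with the factor of size [K] first:
    the initial segments are products of two small types. *)
Lemma prod_injects S X : small K S -> injects X K -> injects (S * X) K.
Proof.
move=> sS jX; have [R [[wfR totR] sR]] := exists_small_wellorder jX.
have [R' [[wfR' totR'] _]] := exists_small_wellorder (small_injects sS).
pose Q (p q : S * X) := R p.2 q.2 \/ p.2 = q.2 /\ R' p.1 q.1.
apply: (@wellorder_injects _ Q); first split.
- move=> [s x]; elim: {x}(wfR x) s => x _ IHx s.
  elim: {s}(wfR' s) => s _ IHs; constructor=> -[t y] [/= yx|/= [-> ts]].
    exact: IHx.
  exact: IHs.
- move=> [s x] [t y]; rewrite /Q /=.
  have [->|[h|h]] := totR x y; [|by right; left; left|by right; right; left].
  have [->|[h|h]] := totR' s t; [by left|by right; left; right|by right; right; right].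
- move=> [s x]; apply/smallP.
  apply: (@small_sub _ _ (S * ({y | R y x} + unit))); last first.
    exact: small_prod sS (small_sum (sR x) small_unit).
  exists (fun u : {p | Q p (s, x)} => ((sval u).1,
     match pselect (R (sval u).2 x) with
     | left p => inl (exist (fun y => R y x) _ p) | right _ => inr tt end)).
  move=> [[t y] p] [[t' y'] p'] /= [et].
  case: (pselect (R y x)) => h; case: (pselect (R y' x)) => h' // e.
    by case: e => ey; apply: sval_inj; rewrite /= et ey.
  apply: sval_inj => /=; rewrite et.
  by case: p => [//|/= [-> _]]; case: p' => [//|/= [-> _]].
Qed.

Lemma small_setU U (A B : set U) :
  small_set K A -> small_set K B -> small_set K (A `|` B).
Proof.
move=> sA sB; apply/small_set_typeP.
apply: small_sub (small_sum ((small_set_typeP _ _).1 sA) ((small_set_typeP _ _).1 sB)).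
have hAB (u : {x | (A `|` B) x}) : exists w : {x | A x} + {x | B x},
    sval u = match w with inl x => sval x | inr x => sval x end.
  case: u => x [h|h]; first by exists (inl (exist _ x h)).
  by exists (inr (exist _ x h)).
have [f fE] := choice hAB.
by exists f => u v e; apply: sval_inj; rewrite !fE e.
Qed.

End Small.

Lemma small_range K X U (f : X -> U) : small K X -> small_set K (range f).
Proof.
move=> /smallP n; apply/small_setP => j; apply: n; apply: injects_trans j _.
apply: (@injects_surj _ _ (fun x => exist (range f) (f x) (ex_intro2 _ _ x I erefl))).
by move=> [y hy]; have [x _ e] := hy; exists x; apply: sval_inj.
Qed.

Lemma small_set_subset K U (A B : set U) : A `<=` B -> small_set K B -> small_set K A.
Proof.
move=> AB /small_setP n; apply/small_setP => j; apply: n; apply: injects_trans j _.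
exact: injects_sub.
Qed.

(** * Definable sets *)

Fixpoint rename_term (L : language) V W (f : V -> W) (t : term L V) : term L W :=
  match t with
  | Var v => Var (f v)
  | App g ts => App g (fun i => rename_term f (ts i))
  end.

Fixpoint rename (L : language) V W (f : V -> W) (phi : formula L V) : formula L W :=
  match phi with
  | Bot => Bot
  | Equal s t => Equal (rename_term f s) (rename_term f t)
  | Relation r ts => Relation r (fun i => rename_term f (ts i))
  | Imp phi psi => Imp (rename f phi) (rename f psi)
  | All phi => All (rename (omap f) phi)
  end.

Lemma eval_rename L (M : structure L) V W (f : V -> W) (e : W -> M) t :
  eval e (rename_term f t) = eval (e \o f) t.
Proof. by elim: t => //= g ts IH; congr fun_int; apply: funext => i. Qed.

Lemma sat_rename L (M : structure L) V W (f : V -> W) (e : W -> M) phi :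
  sat e (rename f phi) <-> sat (e \o f) phi.
Proof.
elim: phi W f e => //= {V}.
- by move=> V s t W f e; rewrite !eval_rename.
- move=> V r ts W f e; rewrite (_ : (fun i => _) = fun i => eval (e \o f) (ts i)) //.
  by apply: funext => i; rewrite eval_rename.
- by move=> V phi IH psi IH' W f e; rewrite IH IH'; exact: iff_refl.
- move=> V phi IH W f e.
  have E m : oapp e m \o omap f = oapp (e \o f) m by apply: funext => -[].
  by split=> h m; [have := h m; rewrite IH E|apply/IH; rewrite E; exact: h].
Qed.

Lemma rename_term_comp L V W Z (f : V -> W) (g : W -> Z) (t : term L V) :
  rename_term g (rename_term f t) = rename_term (g \o f) t.
Proof. by elim: t => //= h ts IH; congr App; apply: funext => i. Qed.

Lemma rename_comp L V W Z (f : V -> W) (g : W -> Z) (phi : formula L V) :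
  rename g (rename f phi) = rename (g \o f) phi.
Proof.
elim: phi W Z f g => //= {V}.
- by move=> V s t W Z f g; rewrite !rename_term_comp.
- by move=> V r ts W Z f g; congr Relation; apply: funext => i; rewrite rename_term_comp.
- by move=> V phi IH psi IH' W Z f g; rewrite IH IH'.
- move=> V phi IH W Z f g; rewrite IH; congr (All (rename _ _)).
  by apply: funext => -[].
Qed.

Lemma term_support L V (t : term L V) :
  exists (F : finType) (f : F -> V) (s : term L F), t = rename_term f s.
Proof.
elim: t => [v|g ts IH]; first by exists unit, (fun=> v), (Var tt).
have [F hF] := choice IH; have [f hf] := dependent_choice hF; have [s hs] := dependent_choice hf.
exists {i : 'I_(fun_ar g) & F i}, (fun u => f _ (tagged u)).
exists (App g (fun i => rename_term (Tagged F) (s i))) => /=.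
by congr App; apply: funext => i; rewrite rename_term_comp hs.
Qed.

(** The bound variable must not be part of the support of [All phi]: the support
    is cut down to the variables of the form [Some v]. *)
Lemma formula_support L V (phi : formula L V) :
  exists (F : finType) (f : F -> V) (psi : formula L F), phi = rename f psi.
Proof.
elim: phi => {V} [V|V s t|V r ts|V phi [F [f [p ->]]] psi [G [g [q ->]]]|V phi].
- by exists void, (of_void V), Bot.
- have [F [f [p ->]]] := term_support s; have [G [g [q ->]]] := term_support t.
  exists (F + G)%type, (fun u => match u with inl x => f x | inr y => g y end).
  by exists (Equal (rename_term inl p) (rename_term inr q)) => /=; rewrite !rename_term_comp.
- have [F hF] := choice (fun i => term_support (ts i)).
  have [f hf] := dependent_choice hF; have [s hs] := dependent_choice hf.
  exists {i : 'I_(rel_ar r) & F i}, (fun u => f _ (tagged u)).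
  exists (Relation r (fun i => rename_term (Tagged F) (s i))) => /=.
  by congr Relation; apply: funext => i; rewrite rename_term_comp hs.
- exists (F + G)%type, (fun u => match u with inl x => f x | inr y => g y end).
  by exists (Imp (rename inl p) (rename inr q)) => /=; rewrite !rename_comp.
- move=> [F [f [p ->]]].
  pose G : finType := {x : F | isSome (f x)}.
  pose get (o : option V) : isSome o -> V :=
    match o with Some v => fun=> v | None => fun h => False_rect _ (notF h) end.
  have getK o (h : isSome o) : Some (get o h) = o by case: o h.
  exists G, (fun u : G => get (f (val u)) (valP u)).
  exists (All (rename (fun x => if insub x is Some u then Some (u : G) else None) p)).
  rewrite /= rename_comp; congr (All (rename _ _)); apply: funext => x /=.
  case: insubP => [u _ <-|] /=; first by rewrite getK.
  by case: (f x).
Qed.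

Lemma parameter_support L X W (phi : formula L (X + W)) :
  exists n (h : 'I_n -> W) (psi : formula L (X + 'I_n)),
    forall (M : structure L) (a : X -> M) (e : W -> M),
      sat (tcat a e) phi <-> sat (tcat a (e \o h)) psi.
Proof.
have [F [f [p ->]]] := formula_support phi.
pose isl (u : X + W) := if u is inl _ then true else false.
pose H : finType := {x : F | ~~ isl (f x)}.
pose getr (u : X + W) : ~~ isl u -> W :=
  match u with inl _ => fun h => False_rect _ (notF h) | inr w => fun=> w end.
have getrK u (h : ~~ isl u) : inr (getr u h) = u by case: u h.
pose k (u : H) := getr (f (val u)) (valP u).
have hF x : exists s : X + H, f x = match s with inl u => inl u | inr u => inr (k u) end.
  have [h|h] := boolP (isl (f x)); first by case: (f x) h => // u _; exists (inl u).
  by exists (inr (Sub x h)); rewrite /k getrK.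
have [s sE] := choice hF.
pose r (u : X + H) : X + 'I_#|H| := match u with inl x => inl x | inr u => inr (enum_rank u) end.
exists #|H|, (fun i => k (enum_val i)), (rename (r \o s) p) => M a e.
rewrite !sat_rename.
rewrite (_ : tcat a e \o f = tcat a (e \o (fun i => k (enum_val i))) \o (r \o s)) //.
by apply: funext => x /=; rewrite sE /r; case: (s x) => //= u; rewrite enum_rankK.
Qed.

Section Definable.
Variables (L : language) (M : structure L).
Implicit Types B : set M.

(** Indexing the parameters by an arbitrary type spares the bookkeeping of finite
    tuples in the closure properties; [definable_psat] returns to finite tuples. *)
Definition definable B V (D : set (V -> M)) : Prop :=
  exists (W : Type) (phi : formula L (V + W)) (e : W -> M),
    range e `<=` B /\ D = [set a | sat (tcat a e) phi].

Lemma definable_sat B V W (phi : formula L (V + W)) (e : W -> M) :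
  range e `<=` B -> definable B [set a : V -> M | sat (tcat a e) phi].
Proof. by move=> eB; exists W, phi, e. Qed.

Lemma definable_sub B B' V (D : set (V -> M)) : B `<=` B' ->
  definable B D -> definable B' D.
Proof. by move=> BB' [W [phi [e [eB ->]]]]; apply: definable_sat => x /eB /BB'. Qed.

Lemma definable_imp B V (D E : set (V -> M)) : definable B D -> definable B E ->
  definable B [set a | D a -> E a].
Proof.
move=> [W [phi [e [eB ->]]]] [W' [psi [e' [eB' ->]]]].
exists (W + W')%type, (Imp
   (rename (fun u => match u with inl x => inl x | inr y => inr (inl y) end) phi)
   (rename (fun u => match u with inl x => inl x | inr y => inr (inr y) end) psi)),
  (tcat e e'); split; first by move=> _ [[x|x] _ <-] /=; [apply: eB|apply: eB']; exists x.
apply/seteqP; split=> a /=; rewrite !sat_rename.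
all: rewrite [tcat a (tcat e e') \o _](_ : _ = tcat a e); last by apply: funext => -[].
all: by rewrite [tcat a (tcat e e') \o _](_ : _ = tcat a e'); last by apply: funext => -[].
Qed.

Lemma definable_false B V : definable B [set _ : V -> M | False].
Proof.
exists void, Bot, (of_void M); split; last by [].
by move=> x [[]].
Qed.

Lemma definable_not B V (D : set (V -> M)) : definable B D ->
  definable B [set a | ~ D a].
Proof. by move=> dD; exact: definable_imp dD (definable_false _ _). Qed.

Lemma definable_and B V (D E : set (V -> M)) : definable B D -> definable B E ->
  definable B [set a | D a /\ E a].
Proof.
move=> dD dE; rewrite [X in definable _ X](_ : _ = [set a | ~ (D a -> ~ E a)]).
  exact/definable_not/definable_imp/definable_not.
apply/seteqP; split=> a /=; first by case=> x y; apply.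
by move=> h; split; apply: contrapT => n; apply: h => // _ .
Qed.

Lemma definable_or B V (D E : set (V -> M)) : definable B D -> definable B E ->
  definable B [set a | D a \/ E a].
Proof.
move=> dD dE; rewrite [X in definable _ X](_ : _ = [set a | ~ D a -> E a]).
  exact/definable_imp/dE/definable_not.
apply/seteqP; split=> a /=; first by case=> // h /(_ h).
by move=> h; have [|/h] := pselect (D a); [left|right].
Qed.

Lemma definable_true B V : definable B [set _ : V -> M | True].
Proof.
rewrite [X in definable _ X](_ : _ = [set _ | False -> False]).
  by apply: definable_imp; exact: definable_false.
by apply/seteqP; split=> a _ /=.
Qed.

Lemma definable_reindex B V W (f : V -> W) (D : set (V -> M)) : definable B D ->
  definable B [set a : W -> M | D (a \o f)].
Proof.
move=> [Z [phi [e [eB ->]]]].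
exists Z, (rename (fun u => match u with inl x => inl (f x) | inr y => inr y end) phi), e.
split=> //; apply/seteqP; split=> a /=; rewrite sat_rename.
all: by rewrite [tcat a e \o _](_ : _ = tcat (a \o f) e) //; apply: funext => -[].
Qed.

Definition update V (a : V -> M) (v : V) (m : M) : V -> M :=
  fun u => if pselect (u = v) then m else a u.

Lemma definable_ex B V (v : V) (D : set (V -> M)) : definable B D ->
  definable B [set a | exists m, D (update a v m)].
Proof.
move=> /definable_not[W [phi [e [eB De]]]].
rewrite [X in definable _ X](_ : _ = [set a | ~ forall m, [set a | ~ D a] (update a v m)]).
  apply: definable_not; rewrite De.
  pose f (u : V + W) : option (V + W) := match u with
    | inl x => if pselect (x = v) then None else Some (inl x) | inr y => Some (inr y) end.
  exists W, (All (rename f phi)), e; split=> //.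
  have E a m : oapp (tcat a e) m \o f = tcat (update a v m) e.
    by apply: funext => -[x|y] //=; rewrite /update; case: pselect.
  by apply/seteqP; split=> a /= h m; move: (h m); rewrite sat_rename E.
by apply/seteqP; split=> a /= h; [case: h => m h /(_ m)|apply: contrapT => n; apply: h => m h; apply: n; exists m].
Qed.

Lemma definable_fix B V U (D : set (V + U -> M)) (e : U -> M) : range e `<=` B ->
  definable B D -> definable B [set a | D (tcat a e)].
Proof.
move=> eB [W [phi [e' [eB' ->]]]].
exists (U + W)%type, (rename (fun u => match u with inl (inl x) => inl x
   | inl (inr x) => inr (inl x) | inr y => inr (inr y) end) phi), (tcat e e').
split; first by move=> _ [[x|x] _ <-] /=; [apply: eB|apply: eB']; exists x.
apply/seteqP; split=> a /=; rewrite sat_rename.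
all: by rewrite [tcat a (tcat e e') \o _](_ : _ = tcat (tcat a e) e') //; apply: funext => -[[]|].
Qed.

(** Formulas over [B] and [d] are moved along conjugates of [d] by making [d]
    variable. *)
Lemma definable_split B V Z (d : Z -> M) (D : set (V -> M)) :
  definable (B `|` range d) D ->
  exists2 D0 : set (V + Z -> M), definable B D0 & D = [set a | D0 (tcat a d)].
Proof.
move=> [W [phi [e [eB ->]]]].
have hW w : exists u : Z + {w | B (e w)},
    e w = match u with inl z => d z | inr x => e (sval x) end.
  have [Bw|[z _ zw]] := eB (e w) (ex_intro2 _ _ w I erefl).
    by exists (inr (exist _ w Bw)).
  by exists (inl z).
have [h hE] := choice hW.
pose e' (x : {w | B (e w)}) := e (sval x).
exists [set a | sat (tcat a e') (rename (fun u => match u with inl x => inl (inl x)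
    | inr w => match h w with inl z => inl (inr z) | inr x => inr x end end) phi)].
  by apply: definable_sat => _ [x _ <-]; exact: (svalP x).
apply/seteqP; split=> a /=; rewrite sat_rename.
all: rewrite [tcat (tcat a d) e' \o _](_ : _ = tcat a e) //.
all: by apply: funext => -[x|w] //=; rewrite hE; case: (h w).
Qed.

Lemma definable_support B V (D : set (V -> M)) : definable B D ->
  exists (F : finType) (f : F -> V) (D' : set (F -> M)),
    definable B D' /\ D = [set a : V -> M | D' (a \o f)].
Proof.
move=> [W [phi [e [eB ->]]]].
have [F [f [p ->]]] := formula_support phi.
pose isl (u : V + W) := if u is inl _ then true else false.
pose G : finType := {x : F | isl (f x)}; pose H : finType := {x : F | ~~ isl (f x)}.
pose getl (u : V + W) : isl u -> V :=
  match u with inl v => fun=> v | inr _ => fun h => False_rect _ (notF h) end.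
pose getr (u : V + W) : ~~ isl u -> W :=
  match u with inl _ => fun h => False_rect _ (notF h) | inr w => fun=> w end.
have getlK u (h : isl u) : inl (getl u h) = u by case: u h.
have getrK u (h : ~~ isl u) : inr (getr u h) = u by case: u h.
pose g (u : G) := getl (f (val u)) (valP u).
pose k (u : H) := getr (f (val u)) (valP u).
have hF x : exists s : G + H, f x = match s with inl u => inl (g u) | inr u => inr (k u) end.
  have [h|h] := boolP (isl (f x)).
    by exists (inl (Sub x h)); rewrite /g getlK.
  by exists (inr (Sub x h)); rewrite /k getrK.
have [s sE] := choice hF.
exists G, g, [set a | sat (tcat a (e \o k)) (rename s p)]; split.
  by apply: definable_sat => _ [x _ <-]; apply: eB; exists (k x).
apply/seteqP; split=> a /=; rewrite !sat_rename.
all: rewrite [tcat a e \o f](_ : _ = tcat (a \o g) (e \o k) \o s) //.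
all: by apply: funext => x /=; rewrite sE; case: (s x).
Qed.

Lemma psat_definable B X (phi : pformula M X) :
  formulas_over B phi -> definable B (fun a => psat a phi).
Proof. by move=> h; exists 'I_(par_nb phi), (pform phi), (par phi). Qed.

Lemma definable_psat B X (D : set (X -> M)) : definable B D ->
  exists2 phi : pformula M X, formulas_over B phi & D = (fun a => psat a phi).
Proof.
move=> [W [phi [e [eB ->]]]].
have [n [h [psi psiE]]] := parameter_support phi.
exists (PFormula n psi (e \o h)); first by move=> _ [i _ <-]; apply: eB; exists (h i).
by apply: funext => a; apply/propext; exact: psiE.
Qed.

Lemma eqtpP B X (a b : X -> M) :
  eqtp B a b <-> forall D, definable B D -> D a -> D b.
Proof.
split=> [e D /definable_psat[phi hphi ->] h|h].
  by have [] : tp b B phi by rewrite -e.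
apply/seteqP; split=> phi [hphi ha]; split=> //.
  exact: (h _ (psat_definable hphi)).
apply: contrapT => hn.
by have /(_ hn) := h _ (definable_not (psat_definable hphi)).
Qed.

Lemma eqtp_iff B X (a b : X -> M) D : eqtp B a b -> definable B D -> D a <-> D b.
Proof. by move=> e dD; split; apply: (eqtpP _ _ _).1 dD. Qed.

Lemma eqtp_sym B X (a b : X -> M) : eqtp B a b -> eqtp B b a. Proof. by []. Qed.

Lemma eqtp_trans B X (a b c : X -> M) : eqtp B a b -> eqtp B b c -> eqtp B a c.
Proof. exact: etrans. Qed.

Lemma eqtp_sub B B' X (a b : X -> M) : B `<=` B' -> eqtp B' a b -> eqtp B a b.
Proof. by move=> BB' /eqtpP h; apply/eqtpP => D dD; exact: (h _ (definable_sub BB' dD)). Qed.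

Lemma eqtp_reindex B X Y (f : Y -> X) (a b : X -> M) :
  eqtp B a b -> eqtp B (a \o f) (b \o f).
Proof. by move=> /eqtpP h; apply/eqtpP => D dD; exact: (h _ (definable_reindex f dD)). Qed.

Lemma eqtp_finite B X (a b : X -> M) :
  (forall (F : finType) (f : F -> X), eqtp B (a \o f) (b \o f)) -> eqtp B a b.
Proof.
move=> h; apply/eqtpP => D /definable_support[F [f [D' [dD' ->]]]].
exact: (eqtpP _ _ _).1 (h F f) _ dD'.
Qed.

Lemma eqtp_tcat B X Z (d : Z -> M) (a b : X -> M) :
  eqtp B (tcat a d) (tcat b d) -> eqtp (B `|` range d) a b.
Proof.
move=> e; apply/eqtpP => D /definable_split[D0 dD0 ->].
exact: (eqtpP _ _ _).1 e _ dD0.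
Qed.

Lemma tcat_eqtp B X Z (d : Z -> M) (a b : X -> M) :
  eqtp (B `|` range d) a b -> eqtp B (tcat a d) (tcat b d).
Proof.
move=> e; apply/eqtpP => D dD.
have sub : range d `<=` B `|` range d by move=> x; right.
apply: ((eqtpP _ _ _).1 e _ (definable_fix sub _)).
by apply: definable_sub dD => x; left.
Qed.

End Definable.

(** * Automorphisms and compactness *)

Lemma wellorder_max V (R : V -> V -> Prop) (F : finType) (Q : F -> Prop) (g : F -> V) :
  wellorder R ->
  (forall x, ~ Q x) \/ exists x, Q x /\ forall y, Q y -> R (g y) (g x) \/ g y = g x.
Proof.
move=> woR; have [wf tot] := woR; have tr := wellorder_trans woR.
have H (l : seq F) : (forall x, x \in l -> ~ Q x) \/
    exists x, Q x /\ forall y, y \in l -> Q y -> R (g y) (g x) \/ g y = g x.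
  elim: l => [|z l [IH|[x [Qx IH]]]]; first by left.
  - have [Qz|nQz] := pselect (Q z); last first.
      by left=> x; rewrite inE => /predU1P[->//|/IH].
    by right; exists z; split=> // y; rewrite inE => /predU1P[->|/IH //]; right.
  - right; have [[Qz xz]|h] := pselect (Q z /\ R (g x) (g z)).
      exists z; split=> // y; rewrite inE => /predU1P[->|yl Qy]; first by right.
      by left; case: (IH y yl Qy) => [/tr|->]; [apply|].
    exists x; split=> // y; rewrite inE => /predU1P[->|yl Qy]; last exact: IH.
    by move=> Qz; have [|[|]] := tot (g z) (g x); [right|left|move=> ?; case: h].
have [h|[x [Qx h]]] := H (enum F); [left=> x|right; exists x; split=> // y].
  by apply: h; rewrite mem_enum.
by apply: h; rewrite mem_enum.
Qed.

Section Automorphism.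
Variables (L : language) (M : structure L).
Implicit Types (A B : set M) (s t : M -> M).

Definition aut_over A s : Prop := automorphism s /\ forall x, A x -> s x = x.

Lemma aut_id A : aut_over A id.
Proof. by split=> //; split=> //; exists id. Qed.

Lemma aut_comp A s t : aut_over A s -> aut_over A t -> aut_over A (s \o t).
Proof.
move=> [[bs fs rs] As] [[bt ft rt] At]; split; first split.
- exact: bij_comp.
- by move=> f u /=; rewrite ft fs.
- by move=> r u /=; rewrite (rs r (fun i => t (u i))) rt.
- by move=> x Ax /=; rewrite At // As.
Qed.

Lemma aut_inv A s : aut_over A s ->
  exists t, [/\ aut_over A t, cancel s t & cancel t s].
Proof.
move=> [[[t st ts] fs rs] As]; exists t; split=> //; split; first split.
- by exists s.
- move=> f u; apply: (can_inj st); rewrite fs ts; congr fun_int.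
  by apply: funext => i; rewrite ts.
- move=> r u; rewrite -rs; rewrite [X in rel_int M r X](_ : _ = u) //.
  by apply: funext => i; rewrite ts.
- by move=> x Ax; rewrite -{1}(As _ Ax) st.
Qed.

Lemma aut_sub A B s : A `<=` B -> aut_over B s -> aut_over A s.
Proof. by move=> AB [hs Bs]; split=> // x /AB/Bs. Qed.

Lemma eval_aut s V (e : V -> M) (t : term L V) : automorphism s -> eval (s \o e) t = s (eval e t).
Proof.
move=> [_ fs _]; elim: t => //= g ts IH; rewrite fs; congr fun_int.
by apply: funext => i.
Qed.

Lemma sat_aut s V (e : V -> M) phi : automorphism s -> sat (s \o e) phi <-> sat e phi.
Proof.
move=> hs; have [[t st ts] fs rs] := hs.
elim: phi e => //= {V}.
- by move=> V u v e; rewrite !eval_aut //; split=> [/(can_inj st)|->].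
- move=> V r u e; rewrite -(rs r (fun i => eval e (u i))).
  rewrite (_ : (fun i => eval (s \o e) (u i)) = fun i => s (eval e (u i))) //.
  by apply: funext => i; rewrite eval_aut.
- by move=> V p IHp q IHq e; rewrite IHp IHq; exact: iff_refl.
- move=> V p IH e; have E m : oapp (s \o e) (s m) = s \o oapp e m by apply: funext => -[].
  split=> h m; first by have := h (s m); rewrite E IH.
  by have := h (t m); rewrite -IH -E ts.
Qed.

Lemma tcat_map s X Y (a : X -> M) (b : Y -> M) :
  s \o tcat a b = tcat (s \o a) (s \o b).
Proof. by apply: funext => -[]. Qed.

Lemma definable_aut A s V (D : set (V -> M)) (a : V -> M) : aut_over A s ->
  definable A D -> D (s \o a) <-> D a.
Proof.
move=> [hs As] [W [phi [e [eA ->]]]] /=.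
rewrite -(sat_aut (tcat a e) _ hs) tcat_map.
rewrite [s \o e](_ : _ = e) //.
by apply: funext => w /=; apply: As; apply: eA; exists w.
Qed.

Lemma definable_move s V B (D : set (V -> M)) : automorphism s -> definable B D ->
  exists2 D', definable (s @` B) D' & forall a, D' (s \o a) <-> D a.
Proof.
move=> hs [W [phi [e [eB ->]]]].
exists [set a | sat (tcat a (s \o e)) phi].
  by apply: definable_sat => _ [w _ <-]; exists (e w) => //; apply: eB; exists w.
by move=> a /=; rewrite -tcat_map sat_aut.
Qed.

Lemma aut_eqtp A s X (a : X -> M) : aut_over A s -> eqtp A a (s \o a).
Proof. by move=> hs; apply/eqtpP => D dD; rewrite (definable_aut _ hs dD). Qed.

Lemma aut_image A s : aut_over A s -> s @` A = A.
Proof.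
move=> [_ As]; apply/seteqP; split=> [_ [x Ax <-]|x Ax]; first by rewrite As.
by exists x => //; rewrite As.
Qed.

Lemma aut_range s X (a : X -> M) : s @` range a = range (s \o a).
Proof.
apply/seteqP; split=> [_ [_ [x _ <-] <-]|_ [x _ <-]]; first by exists x.
by exists (a x) => //; exists x.
Qed.

Lemma aut_fix A X (b : X -> M) s : aut_over A s -> s \o b = b ->
  aut_over (A `|` range b) s.
Proof.
move=> [hs As] sb; split=> // x [/As //|[y _ <-]].
by rewrite -{2}sb.
Qed.

Lemma eqtp_move s B X (a b : X -> M) : automorphism s -> eqtp B a b ->
  eqtp (s @` B) (s \o a) (s \o b).
Proof.
move=> hs e; have [t [[ht _] st ts]] := @aut_inv set0 s (conj hs (fun x => False_ind _)).
apply/eqtpP => D dD; have [D' dD' D'E] := definable_move ht dD.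
move: dD'; rewrite image_comp (_ : t \o s = id) ?image_id => [dD' Da|]; last first.
  by apply: funext => x /=; rewrite st.
apply/D'E.
have E (c : X -> M) : t \o (s \o c) = c by apply: funext => x /=; rewrite st.
by rewrite E -(eqtp_iff e dD') -(E a); apply/D'E.
Qed.

End Automorphism.

Lemma monster_nat L (M : structure L) K : monster M K -> small K nat.
Proof. by case. Qed.

Lemma monster_limit L (M : structure L) K X : monster M K -> small K X -> small K (set X).
Proof. by case=> _ h _ _ _; exact: h. Qed.

Section Compactness.
Variables (L : language) (M : structure L) (K : Type).
Hypothesis mon : monster M K.

Let K_nat := monster_nat mon.
Let K_lim X := @monster_limit _ _ _ X mon.

(** Homogeneity over [A] comes from homogeneity over the empty set, with an
    enumeration of [A] appended to the tuples. *)
Lemma homogeneity (A : set M) X (a b : X -> M) : small_set K A -> small K X ->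
  eqtp A a b -> exists2 s, aut_over A s & s \o a = b.
Proof.
move=> sA sX e; have [_ _ _ _ hom] := mon.
pose d (x : {x | A x}) := sval x.
have sXA : small K (X + {x | A x}).
  by apply: small_sum => //; apply: (small_set_typeP _ _).1.
have [|s hs sE] := hom _ (tcat a d) (tcat b d) sXA.
  apply: tcat_eqtp; apply: eqtp_sub e => x [//|[y _ <-]]; exact: svalP.
exists s; last by apply: funext => x; exact: (sE (inl x)).
by split=> // x Ax; exact: (sE (inr (exist _ x Ax))).
Qed.


Lemma saturation (B : set M) (P : set (set M)) : small_set K B ->
  (forall D, P D -> definable B [set u : unit -> M | D (u tt)]) ->
  (forall n (D : 'I_n -> set M), (forall i, P (D i)) -> exists m, forall i, D i m) ->
  exists m, forall D, P D -> D m.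
Proof.
move=> sB dP fP; have [_ _ _ sat _] := mon.
pose p : set (pformula M unit) := [set phi | formulas_over B phi /\
  exists2 D, P D & [set u : unit -> M | D (u tt)] = (fun u => psat u phi)].
have [||u uP] := sat B p sB.
- by move=> phi [].
- move=> n phi hphi; have {}hphi i := (hphi i).2.
  have {}hphi i : exists D, P D /\
      [set u : unit -> M | D (u tt)] = (fun u => psat u (phi i)).
    by case: (hphi i) => D PD E; exists D.
  have [D hD] := choice hphi.
  have [i|m hm] := fP n D; first by case: (hD i).
  exists (fun=> m) => i; have [_ E] := hD i.
  suff : [set u : unit -> M | D i (u tt)] (fun=> m) by rewrite E.
  exact: hm.
- exists (u tt) => D hD; have [phi hphi e] := definable_psat (dP _ hD).
  suff : [set u : unit -> M | D (u tt)] u by [].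
  by rewrite e; apply: uP; split=> //; exists D.
Qed.

Definition depends_on V (S : set V) (D : set (V -> M)) : Prop :=
  forall a a', (forall v, S v -> a v = a' v) -> D a -> D a'.

Lemma filter_forall T n (F : set (set T)) (D : 'I_n -> set T) : Filter F ->
  (forall i, F (D i)) -> F [set a | forall i, D i a].
Proof.
move=> FF FD; rewrite (_ : [set a | _] =
  [set a | forall i, i \in enum 'I_n -> D i a]); last first.
  by apply/seteqP; split=> a h i *; apply: h; rewrite // mem_enum.
elim: (enum 'I_n) => [|i l IH]; first by apply: filterS filterT => a _ i.
apply: filterS (filterI (FD i) IH) => a [h1 h2] j.
by rewrite inE => /predU1P[->|/h2].
Qed.

Lemma definable_forall B V n (D : 'I_n -> set (V -> M)) :
  (forall i, definable B (D i)) -> definable B [set a | forall i, D i a].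
Proof.
move=> dD; rewrite (_ : [set a | _] =
  [set a | forall i, i \in enum 'I_n -> D i a]); last first.
  by apply/seteqP; split=> a h i *; apply: h; rewrite // mem_enum.
elim: (enum 'I_n) => [|i l IH].
  rewrite [X in definable _ X](_ : _ = [set _ | True]); first exact: definable_true.
  by apply/seteqP; split=> a.
rewrite [X in definable _ X](_ : _ = [set a | D i a /\
    [set a | forall i, i \in l -> D i a] a]); first exact: definable_and.
apply/seteqP; split=> a h.
  by split=> [|j jl]; apply: h; rewrite inE ?eqxx // jl orbT.
by move=> j; rewrite inE => /predU1P[->|/(h.2)]; first exact: h.1.
Qed.

(** Compactness with at most [K] variables. An ultrafilter is a complete type,
    and a realization is found one variable at a time: the variables are
    ordered so that each has few predecessors, hence only saturation for types
    in one variable over small sets is needed. *)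
Lemma ultra_compactness V (B : set M) (U : set (set (V -> M))) :
  injects V K -> small_set K B -> UltraFilter U ->
  exists a, forall D, U D -> definable B D -> D a.
Proof.
move=> jV sB UU; have [R [woR sR]] := exists_small_wellorder jV.
have [wf tot] := woR.
pose good S a := forall D, U D -> definable B D -> depends_on S D -> D a.
pose ext v (r : forall u, R u v -> M) (m : M) : V -> M :=
  fun u => if pselect (R u v) is left h then r u h else m.
have irr v : ~ R v v.
  by elim: {v}(wf v) => v _ IH vv; exact: (IH v).
(* The value at [v] realizes the type over the earlier values; [m'] fills in
   the later variables, on which the formulas in question do not depend. *)
have step v (r : forall u, R u v -> M) : exists m,
    (exists m', good (R^~ v) (ext v r m')) -> good (fun u => R u v \/ u = v) (ext v r m).
  have [[m0 g]|ng] := pselect (exists m', good (R^~ v) (ext v r m')); last first.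
    by have [m] := @carrier_inhabited _ M; exists m => /ng.
  pose r' (u : {u | R u v}) := r (sval u) (proj2_sig u).
  pose P : set (set M) := [set E | exists D, [/\ U D, definable B D,
    depends_on (fun u => R u v \/ u = v) D & E = [set m | D (ext v r m)]]].
  have [|||m hm] := @saturation (B `|` range r') P.
  - by apply: small_setU => //; apply: small_range.
  - move=> _ [D [_ dD _ ->]] /=.
    pose h u : unit + {u | R u v} :=
      if pselect (R u v) is left p then inr (exist _ u p) else inl tt.
    rewrite [X in definable _ X](_ : _ =
       [set u : unit -> M | [set c : unit + {u | R u v} -> M | D (c \o h)] (tcat u r')]).
      apply: definable_fix; first by move=> x; right.
      by apply: definable_reindex; apply: definable_sub dD => x; left.
    have E (u : unit -> M) : ext v r (u tt) = tcat u r' \o h.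
      by apply: funext => w; rewrite /ext /h /=; case: pselect.
    by apply/seteqP; split=> u /=; rewrite E.
  - move=> n E hE.
    have [D hD] := choice hE.
    pose C := [set a | forall i, D i a].
    have UC : U C by apply: filter_forall => i; case: (hD i).
    have dC : definable B C by apply: definable_forall => i; case: (hD i).
    have pC : depends_on (fun u => R u v \/ u = v) C.
      by move=> a a' aa' Ca i; case: (hD i) => _ _ d _; apply: d aa' _; exact: Ca.
    have [m] : [set a | exists m, C (update a v m)] (ext v r m0).
      apply: g.
      - apply: filterS UC => a Ca; exists (a v).
        rewrite (_ : update _ _ _ = a) //; apply: funext => u.
        by rewrite /update; case: pselect => [e|] //=; rewrite e.
      - exact: definable_ex.
      - move=> a a' aa' [m Cm]; exists m; apply: pC Cm => u hu.
        rewrite /update; case: pselect => // uv; apply: aa'.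
        by case: hu.
    move=> Cm; exists m => i; case: (hD i) => _ _ d ->; apply: d (Cm i) => u hu.
    rewrite /update /ext; case: pselect => [e|nuv] /=.
      by case: pselect => // h; case: (irr v); rewrite -{1}e.
    by case: pselect => //; case: hu.
  - by exists m => _ D UD dD pD; apply: (hm (fun m => D (ext v r m))); exists D.
pose G v := projT1 (choice (step v)); have hG v := projT2 (choice (step v)).
pose f := Fix wf (fun=> M) G.
have fE x : f x = G x (fun y _ => f y).
  rewrite /f Fix_eq // => y g g' gg'; congr G.
  by apply: functional_extensionality_dep => z; apply: funext => p.
(* A formula depends on finitely many of the variables in [S], hence on the
   variables up to the last of these. *)
have limit S : (forall v, S v -> good (fun u => R u v \/ u = v) f) -> good S f.
  move=> hS D UD dD pD.
  have [F [g [D' [_ ED]]]] := definable_support dD.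
  have [nS|[x [Sx xmax]]] := wellorder_max (fun x => S (g x)) g woR.
    have [a Da] := filter_ex UD.
    pose a' u := if pselect (S u) then a u else f u.
    have : D a' by apply: pD Da => u Su; rewrite /a'; case: pselect.
    rewrite ED /= (_ : a' \o g = f \o g) //; apply: funext => x /=.
    by rewrite /a'; case: pselect => // Sx; case: (nS _ Sx).
  apply: (hS _ Sx) => // a a' aa' Da; pose b u := if pselect (S u) then a u else a' u.
  have : D b by apply: pD Da => u Su; rewrite /b; case: pselect.
  rewrite ED /= (_ : b \o g = a' \o g) //; apply: funext => y /=.
  by rewrite /b; case: pselect => // Sy; apply/aa'/xmax.
have fgood v : good (fun u => R u v \/ u = v) f.
  elim: {v}(wf v) => v _ IH.
  have E m u : R u v -> f u = ext v (fun u _ => f u) m u.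
    by rewrite /ext; case: pselect.
  have E' u : R u v \/ u = v -> ext v (fun u _ => f u) (f v) u = f u.
    by rewrite /ext; case: pselect => // h [//|->].
  have h : good (fun u => R u v \/ u = v) (ext v (fun u _ => f u) (f v)).
    rewrite (fE v); apply: hG; have [m] := @carrier_inhabited _ M; exists m.
    move=> D UD dD pD; apply: (pD f); first exact: E.
    by apply: (limit (R^~ v)) => // u uv; apply: IH.
  by move=> D UD dD pD; exact: (pD _ _ E' (h _ UD dD pD)).
exists f => D UD dD; apply: (limit setT) => // a a' aa'.
by rewrite (_ : a = a') //; apply: funext => v; exact: aa'.
Qed.

(** The family consists of arbitrary sets of assignments: in some applications its
    members are described by properties, such as being [c o s] for a map [s] on
    indices, that no formula expresses. *)
Lemma compactness V (B : set M) (P : set (set (V -> M))) :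
  injects V K -> small_set K B -> (exists Q, P Q) ->
  (forall Q, P Q -> exists a, Q a) ->
  (forall Q Q', P Q -> P Q' -> exists2 Q'', P Q'' & Q'' `<=` Q `&` Q') ->
  exists a, forall Q D, P Q -> definable B D -> Q `<=` D -> D a.
Proof.
move=> jV sB [Q0 PQ0] Pne Pdir.
have FP : ProperFilter (filter_from P id).
  apply: filter_from_proper; last by move=> Q /Pne.
  by apply: filter_from_filter; first by exists Q0.
have [U [UU PU]] := ultraFilterLemma FP.
have [a ha] := ultra_compactness jV sB UU.
by exists a => Q D PQ dD QD; apply: ha dD; apply: PU; exists Q.
Qed.

End Compactness.

(** * Indiscernible sequences *)

Section Similar.
Variables (L : language) (M : structure L).
Implicit Types (A B : set M).

(** Sequences over possibly different orders that have the same
    Ehrenfeucht-Mostowski type. *)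
Definition similar A d d' (I : orderType d) (J : orderType d') Y
    (a : I -> Y -> M) (b : J -> Y -> M) : Prop :=
  forall (n : nat) (i : 'I_n -> I) (j : 'I_n -> J),
    {homo i : p q / (p < q)%N >-> (p < q)%O} ->
    {homo j : p q / (p < q)%N >-> (p < q)%O} ->
    eqtp A (concat (fun p => a (i p))) (concat (fun p => b (j p))).

(** Sorting the finitely many indices involved reduces patterns, in which terms may
    be repeated, to increasing tuples. *)
Lemma similar_pattern A d d' (I : orderType d) (J : orderType d') Y
    (a : I -> Y -> M) (b : J -> Y -> M) : similar A a b ->
  forall F (f : F -> I) (g : F -> J), (forall x y, (f x < f y)%O = (g x < g y)%O) ->
  eqtp A (concat (fun x => a (f x))) (concat (fun x => b (g x))).
Proof.
move=> ab F f g fg; apply: eqtp_finite => G h.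
pose f0 x := f (tag (h x)); pose g0 x := g (tag (h x)).
have fg0 x y : f0 x = f0 y -> g0 x = g0 y.
  by move=> e; apply/eqP; rewrite eq_le !leNgt -!fg -/(f0 x) -/(f0 y) e ltxx.
pose s := sort <=%O (undup (codom f0)).
have sS : sorted <%O s by rewrite sort_lt_sorted undup_uniq.
have mem x : f0 x \in s by rewrite mem_sort mem_undup codom_f.
have ex (p : 'I_(size s)) : exists x, f0 x = tnth (in_tuple s) p.
  have : tnth (in_tuple s) p \in s by exact: mem_tnth.
  by rewrite mem_sort mem_undup => /codomP[x]; exists x.
have [t tE] := choice ex.
pose idx x : 'I_(size s) := Ordinal (etrans (index_mem (f0 x) s) (mem x)).
have tidx x : f0 (t (idx x)) = f0 x.
  by rewrite tE (tnth_nth (f0 x)) /= nth_index.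
pose r (u : G) : {p : 'I_(size s) & Y} := Tagged (fun=> Y) (tagged (h u) : Y) (i := idx u).
have inc : {homo (fun p => f0 (t p)) : p q / (p < q)%N >-> (p < q)%O}.
  move=> p q pq; rewrite !tE !(tnth_nth (f0 (t p))) /=.
  by apply: (sorted_ltn_nth lt_trans) => //; rewrite inE.
have inc' : {homo (fun p => g0 (t p)) : p q / (p < q)%N >-> (p < q)%O}.
  by move=> p q /inc; rewrite /g0 -fg.
have := eqtp_reindex r (ab _ _ _ inc inc').
rewrite (_ : _ \o r = concat (fun x => a (f x)) \o h); last first.
  by apply: funext => u; rewrite /concat /= tidx.
rewrite (_ : _ \o r = concat (fun x => b (g x)) \o h) //.
by apply: funext => u; rewrite /concat /= (fg0 _ _ (tidx u)).
Qed.

Lemma indiscernible_similar A d (I : orderType d) Y (a : I -> Y -> M) :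
  indiscernible A a <-> similar A a a.
Proof. by []. Qed.

Lemma infinite_chain d (I : orderType d) n : infinite_set [set: I] ->
  exists i : 'I_n -> I, {homo i : p q / (p < q)%N >-> (p < q)%O}.
Proof.
move=> /infiniteP/injects_setP[f fI].
pose s := sort <=%O [seq sval (f i) | i <- iota 0 n].
have sS : sorted <%O s.
  by rewrite sort_lt_sorted map_inj_uniq ?iota_uniq // => x y /sval_inj/fI.
have ss : size s = n by rewrite size_sort size_map size_iota.
exists (fun p => tnth (in_tuple s) (cast_ord (esym ss) p)) => p q pq.
rewrite !(tnth_nth (sval (f 0))) /=.
by apply: (sorted_ltn_nth lt_trans) => //; rewrite inE ss.
Qed.

Lemma similar_trans A d d1 d2 (I : orderType d) (J : orderType d1) (O : orderType d2) Y
    (a : I -> Y -> M) (b : J -> Y -> M) (c : O -> Y -> M) :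
  infinite_set [set: I] -> similar A a b -> similar A a c -> similar A b c.
Proof.
move=> If ab ac n j k hj hk; have [i hi] := infinite_chain n If.
exact: eqtp_trans (eqtp_sym (ab _ _ _ hi hj)) (ac _ _ _ hi hk).
Qed.

Lemma similar_comp A d d1 d2 (I : orderType d) (J : orderType d1) (O : orderType d2) Y
    (a : I -> Y -> M) (b : J -> Y -> M) (c : O -> Y -> M) :
  infinite_set [set: J] -> similar A a b -> similar A b c -> similar A a c.
Proof.
move=> Jf ab bc n i k hi hk; have [j hj] := infinite_chain n Jf.
exact: eqtp_trans (ab _ _ _ hi hj) (bc _ _ _ hj hk).
Qed.

Lemma similar_indiscernible A d d' (I : orderType d) (J : orderType d') Y
    (a : I -> Y -> M) (b : J -> Y -> M) :
  infinite_set [set: I] -> similar A a b -> indiscernible A b.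
Proof. by move=> If ab; apply: (similar_trans (c := b) If ab). Qed.

Lemma similar_eqtp A d (I : orderType d) Y (a b : I -> Y -> M) :
  similar A a b -> eqtp A (concat a) (concat b).
Proof. by move=> ab; apply: (similar_pattern ab (f := id) (g := id)). Qed.

Lemma similar1 A d d' (I : orderType d) (J : orderType d') Y
    (a : I -> Y -> M) (b : J -> Y -> M) i j : similar A a b -> eqtp A (a i) (b j).
Proof.
move=> ab.
have := similar_pattern ab (F := unit) (f := fun=> i) (g := fun=> j).
move=> /(_ (fun _ _ => etrans (ltxx _) (esym (ltxx _)))).
exact: (@eqtp_reindex _ _ _ _ _ (fun y => Tagged (fun=> Y) (i := tt) y)).
Qed.

Lemma indiscernible_sub A B d (I : orderType d) Y (a : I -> Y -> M) :
  A `<=` B -> indiscernible B a -> indiscernible A a.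
Proof. by move=> AB aB n i j hi hj; apply: eqtp_sub AB _; apply: aB. Qed.

Lemma indiscernible_reindex A d (I : orderType d) Y Z (h : Z -> Y) (a : I -> Y -> M) :
  indiscernible A a -> indiscernible A (fun i => a i \o h).
Proof.
move=> aA n i j hi hj.
exact: (@eqtp_reindex _ _ _ _ _ (fun u : {p : 'I_n & Z} =>
  Tagged (fun=> Y) (i := tag u) (h (tagged u)))) (aA _ _ _ hi hj).
Qed.

Lemma indiscernible_const A d (I : orderType d) Y Z (a : I -> Y -> M) (e : Z -> M) :
  indiscernible (A `|` range e) a -> indiscernible A (fun i => tcat (a i) e).
Proof.
move=> aA n i j hi hj; have := tcat_eqtp (aA _ _ _ hi hj).
pose h (u : {p : 'I_n & (Y + Z)%type}) : {p : 'I_n & Y} + Z :=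
  match tagged u with inl y => inl (Tagged (fun=> Y) (i := tag u) y) | inr z => inr z end.
move=> /(eqtp_reindex h).
rewrite (_ : _ \o h = concat (fun p => tcat (a (i p)) e)); last first.
  by apply: funext => -[p [y|z]].
rewrite (_ : _ \o h = concat (fun p => tcat (a (j p)) e)) //.
by apply: funext => -[p [y|z]].
Qed.

Lemma indiscernible_aut s B d (I : orderType d) Y (a : I -> Y -> M) :
  automorphism s -> indiscernible B a -> indiscernible (s @` B) (fun i => s \o a i).
Proof. by move=> hs aB n i j hi hj; apply: (eqtp_move hs (aB _ _ _ hi hj)). Qed.

Lemma indiscernible_aut_over s A d (I : orderType d) Y (a : I -> Y -> M) :
  aut_over A s -> indiscernible A a -> indiscernible A (fun i => s \o a i).
Proof. by move=> hs aA; have := indiscernible_aut hs.1 aA; rewrite (aut_image hs). Qed.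

End Similar.

Section IteratedUltrafilter.
Variable U : set (set nat).
Hypotheses (UU : UltraFilter U) (Uoo : forall n, U [set j | (n < j)%N]).

Fixpoint ultra_seq n (R : seq nat -> Prop) : Prop :=
  if n is n'.+1 then U [set j | ultra_seq n' (fun s => R (j :: s))] else R [::].

(** Unlike [ultra_seq], this allows the comparison of different lists [l] of
    indices; the sets of functions that it holds of for some [l] form a filter. *)
Fixpoint ultra_fun (O : eqType) (l : seq O) (P : (O -> nat) -> Prop) : Prop :=
  if l is o :: l' then U [set j | ultra_fun l' (fun s => s o = j -> P s)]
  else forall s, P s.

Lemma ultra_seq_dec n R : ultra_seq n R \/ ultra_seq n (fun s => ~ R s).
Proof.
elim: n R => [|n IH] R /=; first exact: EM.
have [h|h] := in_ultra_setVsetC [set j | ultra_seq n (fun s => R (j :: s))] UU.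
  by left.
by right; apply: filterS h => j /= h; case: (IH (fun s => R (j :: s))).
Qed.

Variable O : eqType.
Implicit Types (l : seq O) (P : (O -> nat) -> Prop).

Lemma ultra_fun_sub l P P' : (forall s, P s -> P' s) -> ultra_fun l P -> ultra_fun l P'.
Proof.
elim: l P P' => [|o l IH] P P' PP' /=; first by move=> h s; apply: PP'.
by apply: filterS => j; apply: IH => s h /h/PP'.
Qed.

Lemma ultra_fun_and l P P' : ultra_fun l P -> ultra_fun l P' ->
  ultra_fun l (fun s => P s /\ P' s).
Proof.
elim: l P P' => [|o l IH] P P' /=; first by move=> h h' s.
move=> h h'; apply: filterS (filterI h h') => j [h1 h2].
by apply: ultra_fun_sub (IH _ _ h1 h2) => s [h3 h4] e; split; [apply: h3|apply: h4].
Qed.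

Lemma ultra_fun_subseq l l' P : subseq l l' -> ultra_fun l P -> ultra_fun l' P.
Proof.
elim: l' l P => [|o' l' IH] [|o l] P //=.
  move=> _ h; apply: filterS filterT => j _.
  by apply: (IH [::]); [exact: sub0seq|move=> s _; exact: h].
case: eqP => [->|_] sub h; first by apply: filterS h => j; exact: IH.
apply: filterS filterT => j _; apply: (IH (o :: l)) => //=.
by apply: filterS h => i; apply: ultra_fun_sub => s h /h.
Qed.

Lemma ultra_fun_ex l P : uniq l -> ultra_fun l P -> exists s, P s.
Proof.
move=> ul hP; suff H t : exists s : O -> nat, (forall o, o \notin l -> s o = t o) /\ P s.
  by have [s [_ ?]] := H (fun=> 0%N); exists s.
elim: l t P ul hP => [|o l IH] t P /=; first by move=> _ h; exists t.
move=> /andP[ol ul] /filter_ex[j hj].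
have [s [st sP]] := IH (fun x => if x == o then j else t x) _ ul hj.
exists s; split=> [x|].
  by rewrite inE negb_or => /andP[xo xl]; rewrite st // (negbTE xo).
by apply: sP; rewrite st // eqxx.
Qed.

Lemma ultra_fun_path l n : ultra_fun l (fun s => path ltn n (map s l)).
Proof.
elim: l n => [|o l IH] n //=; apply: filterS (Uoo n) => j /= nj.
by apply: ultra_fun_sub (IH j) => s h e; rewrite e nj.
Qed.

Lemma ultra_seq_fun l R : ultra_seq (size l) R -> ultra_fun l (fun s => R (map s l)).
Proof.
elim: l R => [|o l IH] R /=; first by move=> h s.
by apply: filterS => j /IH; apply: ultra_fun_sub => s h ->.
Qed.

End IteratedUltrafilter.

Lemma lt_sorted_subseq d (O : orderType d) (l l' : seq O) :
  sorted <%O l -> sorted <%O l' -> {subset l <= l'} -> subseq l l'.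
Proof.
move=> sl sl' ll'; rewrite (_ : l = [seq x <- l' | x \in l]) ?filter_subseq //.
apply: lt_sorted_eq => //; first exact: lt_sorted_filter.
by move=> x; rewrite mem_filter; case: (boolP (x \in l)) => // /ll' ->.
Qed.

Lemma sorted_map_homo d (O : orderType d) (l : seq O) (s : O -> nat) :
  sorted <%O l -> sorted ltn (map s l) ->
  {in l &, {homo s : x y / (x < y)%O >-> (x < y)%N}}.
Proof.
move=> sl ss x y xl yl xy.
have ixy : (index x l < index y l)%N.
  rewrite ltnNge leq_eqVlt; apply/negP => /orP[/eqP e|h].
    by move: xy; rewrite -(nth_index x xl) -e nth_index // ltxx.
  have := sorted_ltn_nth lt_trans x sl (index y l) (index x l).
  by rewrite !inE !index_mem => /(_ yl xl h); rewrite !nth_index // ltNge ltW.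
have := sorted_ltn_nth ltn_trans (s x) ss (index x l) (index y l).
rewrite !inE !size_map !index_mem => /(_ xl yl ixy).
by rewrite !(nth_map x) ?index_mem // !nth_index.
Qed.

Section Stretch.
Variables (L : language) (M : structure L) (K : Type).
Hypothesis mon : monster M K.
Implicit Types (A B : set M).

Let K_nat := monster_nat mon.
Let K_lim X := @monster_limit _ _ _ X mon.

(** An ultrafilter takes the place of Ramsey's theorem: the formulas that hold of
    terms of the new sequence are those that hold of [c j_1], [c j_2], and so on for
    most [j_1], most [j_2], and so on. This depends on the number of terms only. *)
Theorem stretch_sequence B Y d (O : orderType d) (c : nat -> Y -> M) :
  small_set K B -> small K Y -> injects O K ->
  exists e : O -> Y -> M, indiscernible B e /\
    forall (l : seq O) (D : set (O * Y -> M)), definable B D ->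
      (forall s : O -> nat, {in l &, {homo s : x y / (x < y)%O >-> (x < y)%N}} ->
         D (fun p => c (s p.1) p.2)) ->
      D (fun p => e p.1 p.2).
Proof.
move=> sB sY jO.
have [U [UU Uoo']] := ultraFilterLemma eventually_filter.
have Uoo n : U [set j | (n < j)%N] by apply: Uoo'; exists n.+1.
pose S (P : (O -> nat) -> Prop) : set (O * Y -> M) :=
  [set a | exists2 s, P s & a = fun p => c (s p.1) p.2].
pose fam : set (set (O * Y -> M)) := [set Q | exists (l : seq O) P,
  [/\ sorted <%O l, ultra_fun U l P & Q = S P]].
have [||||a ha] := @compactness _ _ _ mon _ B fam _ sB.
- apply: injects_trans (prod_injects K_nat K_lim sY jO).
  by exists (fun p => (p.2, p.1)) => -[x y] [x' y'] [-> ->].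
- by exists (S (fun=> True)), [::], (fun=> True).
- move=> _ [l [P [sl hP ->]]].
  have [|s Ps] := ultra_fun_ex UU _ hP; first exact: lt_sorted_uniq.
  by exists (fun p => c (s p.1) p.2), s.
- move=> _ _ [l [P [sl hP ->]]] [l' [P' [sl' hP' ->]]].
  pose k := sort <=%O (undup (l ++ l')).
  have sk : sorted <%O k by rewrite sort_lt_sorted undup_uniq.
  exists (S (fun s => P s /\ P' s)).
    exists k, (fun s => P s /\ P' s); split=> //.
    apply: ultra_fun_and => //; [apply: ultra_fun_subseq hP|apply: ultra_fun_subseq hP'] => //;
      apply: lt_sorted_subseq => // x xl;
      by rewrite mem_sort mem_undup mem_cat xl ?orbT.
  by move=> _ [s [Ps P's] ->]; split; exists s.
pose e o y := a (o, y).
have key l P D : sorted <%O l -> ultra_fun U l P -> definable B D ->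
    (forall s, P s -> D (fun p => c (s p.1) p.2)) -> D (fun p => e p.1 p.2).
  move=> sl hP dD PD; rewrite (_ : (fun p => _) = a); last by apply: funext => -[].
  by apply: (ha (S P)) => //; [exists l, P|move=> _ [s Ps ->]; exact: PD].
exists e; split; last first.
  move=> l D dD hD; pose k := sort <=%O (undup l).
  have sk : sorted <%O k by rewrite sort_lt_sorted undup_uniq.
  apply: (key k (fun s => path ltn 0 (map s k))) => //; first exact: ultra_fun_path.
  move=> s /path_sorted h; apply: hD => x y xl yl.
  by apply: (sorted_map_homo sk h); rewrite mem_sort mem_undup.
have ind n (D : set ({p : 'I_n & Y} -> M)) (i : 'I_n -> O) :
    {homo i : p q / (p < q)%N >-> (p < q)%O} -> definable B D ->
    ultra_seq U n (fun s => D (fun u => c (nth 0%N s (tag u)) (tagged u))) ->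
    D (concat (fun p => e (i p))).
  move=> hi dD hD; pose l := codom i.
  have sl : sorted <%O l.
    rewrite /l codomE sorted_map; have := iota_ltn_sorted 0 n.
    rewrite -val_enum_ord sorted_map; apply: sub_sorted => p q; exact: hi.
  have := @ultra_seq_fun _ UU _ l (fun s => D (fun u => c (nth 0%N s (tag u)) (tagged u))).
  rewrite size_codom card_ord => /(_ hD) hQ.
  apply: (key l _ [set b | D (fun u => b (i (tag u), tagged u))] sl hQ).
    exact: (definable_reindex (fun u : {p : 'I_n & Y} => (i (tag u), tagged u)) dD).
  move=> s /=; rewrite (_ : (fun u => _) = fun u => c (s (i (tag u))) (tagged u)) //.
  apply: funext => u; rewrite /l codomE -map_comp (nth_map (tag u)) ?size_enum_ord //=.
  by rewrite nth_ord_enum.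
move=> n i j hi hj; apply/eqtpP => D dD Di.
have [h|h] := ultra_seq_dec UU n
  (fun s => D (fun u => c (nth 0%N s (tag u)) (tagged u))); first exact: ind.
by case: (ind n _ i hi (definable_not dD) h).
Qed.

Lemma stretch_nat A Y d (O : orderType d) (c : nat -> Y -> M) :
  small_set K A -> small K Y -> injects O K -> indiscernible A c ->
  exists2 e : O -> Y -> M, indiscernible A e & similar A c e.
Proof.
move=> sA sY jO cA; have [e [eA eE]] := @stretch_sequence A Y d O c sA sY jO.
exists e => // n i j hi hj; apply/eqtpP => D dD Di.
have dD' := definable_reindex (fun u : {p : 'I_n & Y} => (j (tag u), tagged u)) dD.
apply: (eE (codom j) _ dD') => s hs /=.
apply: (eqtpP _ _ _).1 (cA n i (s \o j) hi _) _ dD Di => p q pq.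
by apply: hs; rewrite ?codom_f //; apply: hj.
Qed.

(** An infinite order has arbitrarily long finite chains, but possibly no
    increasing sequence; compactness takes the limit of the chains. *)
Lemma nat_sequence A Y d (I : orderType d) (c : I -> Y -> M) :
  small_set K A -> small K Y -> infinite_set [set: I] -> indiscernible A c ->
  exists e : nat -> Y -> M, similar A c e.
Proof.
move=> sA sY If cA.
pose S n : set (nat * Y -> M) := [set a | exists2 s : nat -> I,
  (forall i j, (i < j < n)%N -> (s i < s j)%O) & a = fun p => c (s p.1) p.2].
pose fam : set (set (nat * Y -> M)) := [set Q | exists n, Q = S n].
have [||||a ha] := @compactness _ _ _ mon _ A fam _ sA.
- exact: small_injects (small_prod K_nat K_lim K_nat sY).
- by exists (S 0%N), 0%N.
- move=> _ [n ->]; have [i hi] := infinite_chain n If; case: n i hi => [|n] i hi.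
    have [i0 _] := infinite_chain 1 If.
    by exists (fun p => c (i0 ord0) p.2), (fun=> i0 ord0) => // j k; rewrite ltn0 andbF.
  exists (fun p => c (i (inord p.1)) p.2), (fun j => i (inord j)) => // j k /andP[jk kn].
  by apply: hi; rewrite !inordK // (ltn_trans jk).
- move=> _ _ [n ->] [m ->]; exists (S (maxn n m)); first by exists (maxn n m).
  move=> _ [s hs ->]; split; exists s => // i j /andP[ij h];
    by apply: hs; rewrite ij leq_max h ?orbT.
exists (fun n y => a (n, y)) => n i j hi hj; apply/eqtpP => D dD Di.
pose N := (\max_p j p).+1.
have := ha (S N) [set b | D (fun u => b (j (tag u), tagged u))].
apply; first by exists N.
  exact: (definable_reindex (fun u : {p : 'I_n & Y} => (j (tag u), tagged u)) dD).
move=> _ [s hs ->] /=.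
apply: (eqtpP _ _ _).1 (cA n i (s \o j) hi _) _ dD Di => p q pq.
by apply: hs; apply/andP; split; [exact: hj|rewrite ltnS; exact: (@leq_bigmax _ (fun p => j p : nat))].
Qed.

Lemma stretch A Y d d' (I : orderType d) (O : orderType d') (c : I -> Y -> M) :
  small_set K A -> small K Y -> injects O K -> infinite_set [set: I] ->
  indiscernible A c -> exists2 e : O -> Y -> M, indiscernible A e & similar A c e.
Proof.
move=> sA sY jO If cA; have [b cb] := nat_sequence sA sY If cA.
have [e eA be] := stretch_nat sA sY jO (similar_indiscernible If cb).
exists e => // n i j hi hj; apply: eqtp_trans (cb _ i (@nat_of_ord n) hi _) _ => //.
by apply: be.
Qed.

End Stretch.

(** * Dividing and forking *)

Section Forking.
Variables (L : language) (M : structure L) (K : Type).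
Hypothesis mon : monster M K.
Variable A : set M.
Hypothesis A_small : small_set K A.

Let K_nat := monster_nat mon.
Let K_lim X := @monster_limit _ _ _ X mon.

Let smallU B C := @small_setU K K_nat K_lim M B C.

Definition dividing X Y (D : set (X + Y -> M)) (b : Y -> M) : Prop :=
  exists c : nat -> Y -> M, [/\ indiscernible A c, forall i, eqtp A (c i) b &
    ~ exists x, forall i, D (tcat x (c i))].

(** Forking is defined for arbitrary sets, so that a type does not fork exactly
    when no definable set in it does: see [nonforkingE] and [nonforkingI]. *)
Definition forking X (D : set (X -> M)) : Prop :=
  exists k (psi : 'I_k -> pformula M X),
    (forall i, divides A (pform (psi i)) (par (psi i))) /\
    (forall a, D a -> exists i, psat a (psi i)).

Lemma forking_sub X (D D' : set (X -> M)) : D `<=` D' -> forking D' -> forking D.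
Proof. by move=> DD' [k [psi [h1 h2]]]; exists k, psi; split=> // a /DD' /h2. Qed.

Lemma forking_false X : forking [set _ : X -> M | False].
Proof.
exists 0%N, (fun i : 'I_0 => False_rect _ (notF (ltn_ord i : false))).
by split=> [[]|].
Qed.

Lemma forking_or X (D D' : set (X -> M)) : forking D -> forking D' ->
  forking [set a | D a \/ D' a].
Proof.
move=> [k [psi [h1 h2]]] [k' [psi' [h1' h2']]].
exists (k + k')%N, (fun i => match fintype.split i with inl j => psi j | inr j => psi' j end).
split=> [i|a [/h2[i hi]|/h2'[i hi]]]; first by case: (fintype.split i).
- by exists (lshift k' i); rewrite (unsplitK (inl i)).
- by exists (rshift k i); rewrite (unsplitK (inr i)).
Qed.

Lemma divides_aut X Y (phi : formula L (X + Y)) (b : Y -> M) s : aut_over A s ->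
  divides A phi b -> divides A phi (s \o b).
Proof.
move=> hs [c [cA cb ninc]]; exists c; split=> // i.
exact: eqtp_trans (cb i) (aut_eqtp _ hs).
Qed.

Lemma forking_aut X (D : set (X -> M)) s : aut_over A s ->
  forking D -> forking [set a | D (s \o a)].
Proof.
move=> hs [k [psi [h1 h2]]]; have [t [ht st ts]] := aut_inv hs.
exists k, (fun i => PFormula (par_nb (psi i)) (pform (psi i)) (t \o par (psi i))).
split=> [i|a /h2[i]]; first exact: divides_aut ht (h1 i).
rewrite /psat -(sat_aut (tcat _ (par _)) _ ht.1) tcat_map => h; exists i.
by move: h; rewrite (_ : t \o (s \o a) = a) //; apply: funext => x /=; rewrite st.
Qed.

Lemma forking_reindex X Y (f : X -> Y) (D : set (X -> M)) :
  forking D -> forking [set a : Y -> M | D (a \o f)].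
Proof.
move=> [k [psi [h1 h2]]].
pose g n (u : X + 'I_n) : Y + 'I_n := match u with inl x => inl (f x) | inr i => inr i end.
have gE n (a : Y -> M) (b : 'I_n -> M) : tcat a b \o @g n = tcat (a \o f) b.
  by apply: funext => -[].
exists k, (fun i => PFormula (par_nb (psi i)) (rename (@g _) (pform (psi i))) (par (psi i))).
split=> [i|a /h2[i hi]]; last by exists i; rewrite /psat /= sat_rename gE.
have [c [cA cb ninc]] := h1 i; exists c; split=> //= -[a ha]; apply: ninc.
by exists (a \o f) => j; have := ha j; rewrite sat_rename gE.
Qed.

Lemma nonforkingE X (a : X -> M) B D : nonforking A a B ->
  definable (A `|` B) D -> D a -> ~ forking D.
Proof.
move=> nf /definable_psat[phi hphi ->] ha hf; apply: nf; exists phi; split=> // b.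
by apply.
Qed.

(** By compactness, a formula that a type implies is implied by a single formula of
    the type. *)
Lemma nonforkingI X (a : X -> M) B : small K X -> small_set K B ->
  (forall D, definable (A `|` B) D -> D a -> ~ forking D) -> nonforking A a B.
Proof.
move=> sX sB h [phi [tphi fphi]].
have [D [dD Da Dphi]] : exists D, [/\ definable (A `|` B) D, D a &
    forall b, D b -> psat b phi].
  apply: contrapT => nD.
  pose fam : set (set (X -> M)) := [set Q | exists D,
    [/\ definable (A `|` B) D, D a & Q = [set b | D b /\ ~ psat b phi]]].
  have [|||||b hb] := @compactness _ _ _ mon _ (A `|` B `|` range (par phi)) fam.
  - exact: small_injects.
  - apply: smallU => //; first exact: smallU.
    by apply: small_range; exact: small_ord.
  - exists [set b | True /\ ~ psat b phi], [set _ | True]; split=> //.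
    exact: definable_true.
  - move=> _ [D [dD Da ->]]; apply: contrapT => ne; apply: nD; exists D; split=> // b Db.
    by apply: contrapT => nb; apply: ne; exists b.
  - move=> _ _ [D [dD Da ->]] [D' [dD' Da' ->]].
    exists [set b | (D b /\ D' b) /\ ~ psat b phi]; last by move=> b [[]].
    exists [set b | D b /\ D' b]; split=> //; exact: definable_and.
  have tb : realizes b (tp a (A `|` B)).
    move=> psi [hpsi pa].
    apply: (hb [set b | psat b psi /\ ~ psat b phi] (fun b => psat b psi)).
    + by exists (fun b => psat b psi); split=> //; exact: psat_definable.
    + by apply: definable_sub (psat_definable hpsi) => x; left.
    + by move=> x [].
  have [] : [set b | ~ psat b phi] b; last exact: tphi.
  apply: (hb [set b | True /\ ~ psat b phi]) => //; last by move=> x [].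
  + by exists [set _ | True]; split=> //; exact: definable_true.
  + by apply/definable_not/psat_definable => x hx; right.
by apply: (h D) => //; apply: forking_sub fphi.
Qed.

Lemma nonforking_sub X (a : X -> M) B B' : B `<=` B' ->
  nonforking A a B' -> nonforking A a B.
Proof.
move=> BB' nf [phi [tphi fphi]]; apply: nf; exists phi; split=> // b hb.
apply: tphi => psi [hpsi pa]; apply: hb; split=> // x /hpsi[Ax|Bx]; first by left.
by right; apply: BB'.
Qed.

Lemma nonforking_reindex X Y (f : Y -> X) (a : X -> M) B : small K Y -> small_set K B ->
  nonforking A a B -> nonforking A (a \o f) B.
Proof.
move=> sY sB nf; apply: nonforkingI => // D dD Da fD.
exact: (nonforkingE nf (definable_reindex f dD) Da (forking_reindex f fD)).
Qed.

Lemma nonforking_aut X (a : X -> M) B s : small K X -> small_set K B ->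
  aut_over A s -> nonforking A a B -> nonforking A (s \o a) (s @` B).
Proof.
move=> sX sB hs nf; have [t [ht st ts]] := aut_inv hs.
apply: nonforkingI => //.
  apply: (@small_set_subset _ _ _ (range (fun x : {x | B x} => s (sval x)))).
    by move=> _ [x Bx <-]; exists (exist _ x Bx).
  by apply: small_range; apply: (small_set_typeP _ _).1.
move=> D dD Da fD; have [D' + D'E] := definable_move ht.1 dD.
rewrite image_setU (aut_image ht) image_comp (_ : t \o s = id) ?image_id; last first.
  by apply: funext => x /=; rewrite st.
move=> dD'.
have E (b : X -> M) : t \o (s \o b) = b by apply: funext => x /=; rewrite st.
apply: (nonforkingE nf dD'); first by rewrite -(E a) D'E.
apply: forking_sub (forking_aut hs fD) => b; rewrite -{1}(E b) D'E.
exact.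
Qed.

Lemma nonforking_eqtp X Y (a a' : X -> M) (c c' : Y -> M) : small K X -> small K Y ->
  eqtp A (tcat a c) (tcat a' c') ->
  nonforking A a (range c) -> nonforking A a' (range c').
Proof.
move=> sX sY e nf.
have [s hs sE] := homogeneity mon A_small (small_sum K_nat K_lim sX sY) e.
have sa : s \o a = a' by apply: funext => x; have := congr1 (@^~ (inl x)) sE.
have sc : s \o c = c' by apply: funext => x; have := congr1 (@^~ (inr x)) sE.
rewrite -sa -sc -aut_range; apply: nonforking_aut => //; exact: small_range.
Qed.

(** Parameters from [A] may be used in dividing formulas: they are constant
    along sequences that are indiscernible over [A]. *)
Lemma dividing_divides X Y (D : set (X + Y -> M)) (b : Y -> M) :
  definable A D -> dividing D b ->
  exists2 psi : pformula M X, divides A (pform psi) (par psi) &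
    [set x | D (tcat x b)] = (fun x => psat x psi).
Proof.
move=> [W [phi [e [eA ->]]]] [c [cA cb ninc]].
pose g (u : (X + Y) + W) : X + (Y + W) := match u with
  | inl (inl x) => inl x | inl (inr y) => inr (inl y) | inr w => inr (inr w) end.
have [n [h [psi psiE]]] := parameter_support (rename g phi).
have gE (x : X -> M) (y : Y -> M) : tcat x (tcat y e) \o g = tcat (tcat x y) e.
  by apply: funext => -[[]|].
have AE : A `|` range e = A by apply/seteqP; split=> x; [case=> // /eA|left].
have E x y : sat (tcat (tcat x y) e) phi <-> sat (tcat x (tcat y e \o h)) psi.
  by rewrite -psiE sat_rename gE.
exists (PFormula n psi (tcat b e \o h)); last first.
  by apply: funext => x; apply/propext; exact: E.
exists (fun i => tcat (c i) e \o h); split.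
- by apply: indiscernible_reindex; apply: indiscernible_const; rewrite AE.
- by move=> i; apply: eqtp_reindex; apply: tcat_eqtp; rewrite AE.
- by move=> [x hx]; apply: ninc; exists x => i; apply/E.
Qed.

Lemma dividing_forking X Y (D : set (X + Y -> M)) (b : Y -> M) :
  definable A D -> dividing D b -> forking [set x | D (tcat x b)].
Proof.
move=> dD /(dividing_divides dD)[psi hpsi ->].
by exists 1%N, (fun=> psi); split=> // a ha; exists ord0.
Qed.

Lemma nonforking_consistent X Y (a : X -> M) (b : Y -> M) (c : nat -> Y -> M) D :
  nonforking A a (range b) -> indiscernible A c -> eqtp A (c 0%N) b ->
  definable A D -> D (tcat a b) -> exists x, forall i, D (tcat x (c i)).
Proof.
move=> nf cA cb dD Dab; apply: contrapT => ninc.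
apply: (nonforkingE nf (D := [set x | D (tcat x b)])) => //.
  apply: definable_fix; first by move=> x; right.
  by apply: definable_sub dD => x; left.
apply: dividing_forking => //; exists c; split=> // i.
by apply: eqtp_trans cb; apply: similar1; exact/indiscernible_similar.
Qed.

(** Conjugate the sequence by automorphisms that carry the longer tuple, and
    make the result indiscernible again. *)
Lemma dividing_longer X Y Z (f : Y -> Z) (D : set (X + Y -> M)) (b : Z -> M) :
  small K X -> small K Y -> small K Z -> definable A D -> dividing D (b \o f) ->
  dividing [set u : X + Z -> M |
    D (u \o (fun v => match v with inl x => inl x | inr y => inr (f y) end))] b.
Proof.
move=> sX sY sZ dD [c [cA cb ninc]].
have hs i : exists s, aut_over A s /\ s \o (b \o f) = c i.
  by have [s ? ?] := homogeneity mon A_small sY (eqtp_sym (cb i)); exists s.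
have [s sE] := choice hs.
have jn : injects nat K by exact: small_injects.
have [e [eA eE]] := @stretch_sequence _ _ _ mon A Z _ nat (fun i => s i \o b) A_small sZ jn.
exists e; split=> //.
- move=> i; apply/eqtpP => E dE Ei; apply: contrapT => nE.
  have dE' := definable_reindex (fun z => (i, z)) (definable_not dE).
  apply: (eE [::] _ dE') Ei => t _ /= Eb; apply: nE.
  by apply/(definable_aut b (sE (t i)).1 dE).
- move=> [x hx]; apply: ninc.
  have ce : similar A c (fun i => e i \o f).
    move=> n i j hi hj; apply/eqtpP => E dE Ei.
    have dE' := definable_reindex (fun u : {p : 'I_n & Y} => (j (tag u), f (tagged u))) dE.
    apply: (eE (codom j) _ dE') => t ht /=.
    have tj : {homo (t \o j) : p q / (p < q)%N >-> (p < q)%O}.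
      by move=> p q pq; apply: ht; rewrite ?codom_f //; apply: hj.
    have := (eqtpP _ _ _).1 (cA n i _ hi tj) _ dE Ei.
    rewrite (_ : concat _ = fun u => s (t (j (tag u))) (b (f (tagged u)))) //.
    by apply: funext => u; rewrite /concat /= -(sE _).2.
  have snY : small K {p : nat & Y} by exact: small_tagged.
  have [r hr rE] := homogeneity mon A_small snY (eqtp_sym (similar_eqtp ce)).
  exists (r \o x) => i; have := hx i; rewrite /= -(definable_aut _ hr dD).
  rewrite (_ : r \o _ = tcat (r \o x) (c i)) //.
  apply: funext => -[x'|y] //=.
  exact: (congr1 (@^~ (Tagged (fun=> Y) (i := i) y)) rE).
Qed.

(** Padding the parameters allows a single sequence to be tested against all the
    dividing formulas at once. *)
Lemma forking_common X (D : set (X -> M)) : small K X -> forking D ->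
  exists (Y : finType) (b : Y -> M) k (E : 'I_k -> set (X + Y -> M)),
    [/\ forall t, definable A (E t), forall t, dividing (E t) b &
        forall a, D a -> exists t, E t (tcat a b)].
Proof.
move=> sX [k [psi [h1 h2]]].
pose Y : finType := {t : 'I_k & 'I_(par_nb (psi t))}.
pose b (u : Y) := par (psi (tag u)) (tagged u).
pose f t (i : 'I_(par_nb (psi t))) : Y := Tagged (fun t => 'I_(par_nb (psi t))) i.
pose E0 t : set (X + 'I_(par_nb (psi t)) -> M) := [set u | sat u (pform (psi t))].
have dE0 t : definable A (E0 t).
  exists void, (rename inl (pform (psi t))), (of_void M); split; first by move=> x [[]].
  by apply/seteqP; split=> u; rewrite /E0 /= sat_rename.
pose g t (v : X + 'I_(par_nb (psi t))) : X + Y :=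
  match v with inl x => inl x | inr y => inr (f t y) end.
exists Y, b, k, (fun t => [set u : X + Y -> M | E0 t (u \o g t)]); split.
- by move=> t; apply: definable_reindex.
- move=> t; apply: (dividing_longer (f := f t)) => //; try exact: small_finType.
  exact: h1.
- move=> a /h2[t ht]; exists t; rewrite /E0 /=.
  by rewrite (_ : _ \o g t = tcat a (par (psi t))) //; apply: funext => -[].
Qed.

(** Some [x] has the type of [a] over each term of the sequence, because no formula
    in that type divides. Make the sequence indiscernible over [x] and move [x] back
    to [a]. *)
Lemma indiscernible_over X Y (a : X -> M) (b : Y -> M) (c : nat -> Y -> M) :
  small K X -> small K Y -> nonforking A a (range b) -> indiscernible A c -> c 0%N = b ->
  exists c' : nat -> Y -> M,
    [/\ indiscernible (A `|` range a) c', c' 0%N = b & similar A c c'].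
Proof.
move=> sX sY nf cA c0.
pose fam : set (set (X -> M)) := [set Q | exists D : set (X + Y -> M),
  [/\ definable A D, D (tcat a b) & Q = [set x | forall i, D (tcat x (c i))]]].
have snY : small K {p : nat & Y} by exact: small_tagged.
have [|||||x hx] := @compactness _ _ _ mon _ (A `|` range (concat c)) fam.
- exact: small_injects.
- by apply: smallU => //; apply: small_range.
- exists [set x | forall i : nat, True], [set _ | True]; split=> //; exact: definable_true.
- move=> _ [D [dD Dab ->]]; apply: nonforking_consistent nf cA _ dD Dab.
  by rewrite c0.
- move=> _ _ [D [dD Dab ->]] [D' [dD' Dab' ->]].
  exists [set x | forall i, D (tcat x (c i)) /\ D' (tcat x (c i))].
    by exists [set u | D u /\ D' u]; split=> //; exact: definable_and.
  by move=> x h; split=> i; case: (h i).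
have xc i : eqtp A (tcat a b) (tcat x (c i)).
  apply/eqtpP => D dD Dab.
  apply: (hx [set x | forall i, D (tcat x (c i))] [set x | D (tcat x (c i))]).
  + by exists D.
  + apply: definable_fix; last by apply: definable_sub dD => y; left.
    by move=> _ [y _ <-]; right; exists (Tagged (fun=> Y) (i := i) y).
  + by move=> y /(_ i).
have jn : injects nat K by exact: small_injects.
have sAx : small_set K (A `|` range x) by apply: smallU => //; apply: small_range.
have [e [eAx eE]] := @stretch_sequence _ _ _ mon (A `|` range x) Y _ nat c sAx sY jn.
have ce : similar A c e.
  move=> n i j hi hj; apply/eqtpP => D dD Di.
  have dD' := definable_reindex (fun u : {p : 'I_n & Y} => (j (tag u), tagged u)) dD.
  apply: (eE (codom j) _ (definable_sub (@subsetUl _ A (range x)) dD')).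
  move=> t ht /=; apply: (eqtpP _ _ _).1 (cA n i (t \o j) hi _) _ dD Di => p q pq.
  by apply: ht; rewrite ?codom_f //; apply: hj.
have xe : eqtp A (tcat x (e 0%N)) (tcat a b).
  apply/eqtp_sym/eqtpP => D dD Dab.
  apply: (eE [::] [set u | D (tcat x (fun y => u (0%N, y)))]).
    pose h (u : X + Y) : (nat * Y) + X :=
      match u with inl x => inr x | inr y => inl (0%N, y) end.
    rewrite [X in definable _ X](_ : _ =
       [set u : nat * Y -> M | [set v : (nat * Y) + X -> M | D (v \o h)] (tcat u x)]).
      apply: definable_fix; first by move=> y; right.
      by apply: definable_reindex; apply: definable_sub dD => y; left.
    have E (u : nat * Y -> M) : tcat x (fun y => u (0%N, y)) = tcat u x \o h.
      by apply: funext => -[].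
    by apply/seteqP; split=> u /=; rewrite E.
  by move=> t _ /=; apply: (eqtpP _ _ _).1 (xc (t 0%N)) _ dD Dab.
have [s hs sE] := homogeneity mon A_small (small_sum K_nat K_lim sX sY) xe.
have sx : s \o x = a by apply: funext => y; have := congr1 (@^~ (inl y)) sE.
have se : s \o e 0%N = b by apply: funext => y; have := congr1 (@^~ (inr y)) sE.
exists (fun i => s \o e i); split=> //.
  have := indiscernible_aut hs.1 eAx.
  by rewrite image_setU (aut_image hs) aut_range sx.
move=> n i j hi hj; apply: eqtp_trans (ce _ _ _ hi hj) _.
exact: (aut_eqtp _ hs).
Qed.

(** A formula that forked between two terms of the new sequence would hold, for some
    choice of indices, of two terms of the old one. *)
Lemma nonforking_stretch B Y Z Y' d (O : orderType d) (c : nat -> Y -> M)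
    (e : O -> Y -> M) (o o' : O) (f : Y' -> Y) (g : Z -> Y) :
  A `<=` B -> small K Y -> small K Y' -> small K Z ->
  (forall (l : seq O) (D : set (O * Y -> M)), definable B D ->
      (forall s : O -> nat, {in l &, {homo s : x y / (x < y)%O >-> (x < y)%N}} ->
         D (fun p => c (s p.1) p.2)) ->
      D (fun p => e p.1 p.2)) ->
  (forall i, eqtp A (c i \o g) (e o' \o g)) ->
  (forall s : O -> nat, {in [:: o; o'] &, {homo s : x y / (x < y)%O >-> (x < y)%N}} ->
     nonforking A (c (s o) \o f) (range (c (s o') \o g))) ->
  nonforking A (e o \o f) (range (e o' \o g)).
Proof.
move=> AB sY sY' sZ eE ce nf; apply: nonforkingI => //; first exact: small_range.
move=> D /definable_split[D0 dD0 ->] De fD.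
pose h (u : Y' + Z) : O * Y := match u with inl y => (o, f y) | inr z => (o', g z) end.
have E (u : O -> Y -> M) : (fun p => u p.1 p.2) \o h = tcat (u o \o f) (u o' \o g).
  by apply: funext => -[].
have : [set u | ~ [set v : O * Y -> M | D0 (v \o h)] u] (fun p => e p.1 p.2).
  apply: (eE [:: o; o']).
    by apply/definable_not/definable_reindex/(definable_sub AB).
  move=> s /nf hs; rewrite /= (E (fun o => c (s o))) => Ds.
  apply: (nonforkingE hs (D := [set x | D0 (tcat x (c (s o') \o g))])) => //.
    apply: definable_fix; first by move=> x; right.
    by apply: definable_sub dD0 => x; left.
  have [r hr rE] := homogeneity mon A_small sZ (ce (s o')).
  apply: forking_sub (forking_aut hr fD) => x Dx /=.
  by rewrite -rE -tcat_map (definable_aut _ hr dD0).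
by rewrite /= E.
Qed.

Section ExtensionBase.
Hypothesis A_base : extension_base K A.

(** A formula in the type of [a] over [A] does not fork, so forking formulas over [B]
    cannot cover it; conclude by compactness. *)
Lemma nonforking_extension X (a : X -> M) B : small K X -> small_set K B ->
  exists a', eqtp A a a' /\ nonforking A a' B.
Proof.
move=> sX sB.
pose fam : set (set (X -> M)) := [set Q | exists D E,
  [/\ definable A D, D a, forking E & Q = [set x | D x /\ ~ E x]]].
have [|||||a' ha'] := @compactness _ _ _ mon _ (A `|` B) fam.
- exact: small_injects.
- exact: smallU.
- exists [set x | True /\ ~ False], [set _ | True], [set _ | False]; split=> //.
    exact: definable_true.
  exact: forking_false.
- move=> _ [D [E [dD Da fE ->]]]; apply: contrapT => ne.
  apply: (nonforkingE (@A_base X a sX) (D := D) _ Da).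
    by apply: definable_sub dD => x; left.
  apply: forking_sub fE => x Dx; apply: contrapT => nE; apply: ne.
  by exists x.
- move=> _ _ [D [E [dD Da fE ->]]] [D' [E' [dD' Da' fE' ->]]].
  exists [set x | (D x /\ D' x) /\ ~ (E x \/ E' x)].
    exists [set x | D x /\ D' x], [set x | E x \/ E' x]; split=> //.
      exact: definable_and.
    exact: forking_or.
  by move=> x [[h1 h2] h3]; split; split=> // h; apply: h3; [left|right].
exists a'; split.
  apply/eqtpP => D dD Da.
  apply: (ha' [set x | D x /\ ~ False] D); last by move=> x [].
    by exists D, [set _ | False]; split=> //; exact: forking_false.
  by apply: definable_sub dD => x; left.
apply: nonforkingI => // E dE Ea' fE.
have : [set x | ~ E x] a'; last by apply.
apply: (ha' [set x | True /\ ~ E x]); last by move=> x [].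
  by exists [set _ | True], E; split=> //; exact: definable_true.
exact: definable_not.
Qed.

Lemma nonforking_empty X (a : X -> M) B : (X -> False) -> small_set K B ->
  nonforking A a B.
Proof.
move=> nX sB; have sX : small K X.
  by apply: (small_finite K_nat); exists 0%N, (fun x => False_rect _ (nX x)) => x; case: (nX x).
have [a' [_]] := nonforking_extension a sX sB.
by rewrite (_ : a' = a) //; apply: funext => x; case: (nX x).
Qed.

Hypothesis A_trivial : left_totally_trivial K A.

(** A formula involves finitely many entries, and total triviality joins these one at a
    time. *)
Lemma nonforking_entries X Y (a : X -> M) (c : Y -> M) : small K X -> small K Y ->
  (forall x, nonforking A (fun _ : unit => a x) (range c)) -> nonforking A a (range c).
Proof.
move=> sX sY nf; have sc : small_set K (range c) by exact: small_range.
have fin n (b : 'I_n -> M) : (forall x, nonforking A (fun _ : unit => b x) (range c)) ->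
    nonforking A b (range c).
  elim: n b => [|n IH] b hb; first by apply: nonforking_empty => // -[].
  have h : nonforking A (tcat (b \o lift ord0) (fun _ : unit => b ord0)) (range c).
    apply: A_trivial => //; try exact: small_ord; first exact: small_unit.
    by apply: IH => x; exact: hb.
  pose f (i : 'I_n.+1) : 'I_n + unit := if unlift ord0 i is Some j then inl j else inr tt.
  rewrite (_ : b = tcat (b \o lift ord0) (fun _ : unit => b ord0) \o f).
    by apply: nonforking_reindex => //; exact: small_ord.
  by apply: funext => i; rewrite /f /=; case: unliftP => [j ->|->].
have [[x0 _]|nX] := pselect (exists x : X, True); last first.
  by apply: nonforking_empty => // x; apply: nX; exists x.
apply: nonforkingI => // D dD Da fD.
have [F [f [D' [dD' DE]]]] := definable_support dD.
(* The extra point provides a default value for the retraction [g]. *)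
pose G : finType := option F.
pose f' (u : G) : X := if u is Some x then f x else x0.
have hg x : exists u, (exists v, f' v = x) -> f' u = x.
  have [[v <-]|n] := pselect (exists v, f' v = x); first by exists v.
  by exists None => /n.
have [g gE] := choice hg.
have gK u : f' (g (f' u)) = f' u by apply: gE; exists u.
have nfG : nonforking A (a \o f') (range c).
  rewrite (_ : a \o f' = (fun i : 'I_#|G| => a (f' (enum_val i))) \o enum_rank).
    by apply: nonforking_reindex => //; [exact: small_finType|exact: fin].
  by apply: funext => u /=; rewrite enum_rankK.
apply: (nonforkingE nfG (D := [set y : G -> M | D (y \o g)])).
- exact: definable_reindex.
- move: Da; rewrite DE /= (_ : (a \o f') \o g \o f = a \o f) //.
  by apply: funext => x /=; have /= -> := gK (Some x).
- exact: forking_reindex.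
Qed.

End ExtensionBase.
End Forking.

(** * Consequences of NIP *)

Section Paths.
Variables (L : language) (M : structure L).

(** Changing one row at a time: a formula involves finitely many rows. *)
Lemma paths_eqtp (B : set M) S Y (R : S -> nat -> Y -> M) :
  (forall s l l', eqtp (B `|` \bigcup_(t in [set t | t <> s]) range (concat (R t)))
     (R s l) (R s l')) ->
  forall p q : S -> nat,
    eqtp B (concat (fun s => R s (p s))) (concat (fun s => R s (q s))).
Proof.
move=> hR.
have one s (p q : S -> nat) : (forall t, t <> s -> p t = q t) ->
    eqtp B (concat (fun s => R s (p s))) (concat (fun s => R s (q s))).
  move=> pq; apply/eqtpP => D dD.
  pose W := {u : {s : S & Y} | tag u <> s}.
  pose e (u : W) := R (tag (sval u)) (p (tag (sval u))) (tagged (sval u)).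
  pose h (u : {s : S & Y}) : Y + W := match pselect (tag u = s) with
    | left _ => inl (tagged u) | right n => inr (exist _ u n) end.
  have dD' : definable (B `|` \bigcup_(t in [set t | t <> s]) range (concat (R t)))
      [set y : Y -> M | [set w : Y + W -> M | D (w \o h)] (tcat y e)].
    apply: definable_fix; last first.
      by apply: definable_reindex; apply: definable_sub dD => x; left.
    move=> _ [u _ <-]; right; exists (tag (sval u)); first exact: (svalP u).
    by exists (Tagged (fun=> Y) (i := p (tag (sval u))) (tagged (sval u))).
  have E (r : S -> nat) : (forall t, t <> s -> p t = r t) ->
      tcat (R s (r s)) e \o h = concat (fun s => R s (r s)).
    move=> pr; apply: funext => -[t y]; rewrite /h /concat /=.
    by case: pselect => [->|n] //=; rewrite /e /= pr.
  move=> Dp; rewrite -(E q pq); apply: (eqtpP _ _ _).1 (hR s (p s) (q s)) _ dD' _.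
  by rewrite /= E.
move=> p q; apply: eqtp_finite => F f.
pose r (l : seq F) s := if pselect (exists2 x, x \in l & tag (f x) = s) then q s else p s.
have H l : eqtp B (concat (fun s => R s (p s))) (concat (fun s => R s (r l s))).
  elim: l => [|x l IH].
    rewrite (_ : r [::] = p) //; apply: funext => s; rewrite /r.
    by case: pselect => // -[].
  apply: eqtp_trans IH _; apply: (one (tag (f x))) => t tx; rewrite /r.
  case: pselect => h; case: pselect => h' //; exfalso.
    by apply: h'; have [y yl e] := h; exists y; rewrite // inE yl orbT.
  have [y] := h'; rewrite inE => /predU1P[-> e|yl e]; first by case: tx.
  by apply: h; exists y.
apply: eqtp_trans (eqtp_reindex f (H (enum F))) _.
rewrite (_ : concat _ \o f = concat (fun s => R s (q s)) \o f) //.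
apply: funext => x; rewrite /concat /= /r; case: pselect => // -[].
by exists x; rewrite ?mem_enum.
Qed.

End Paths.

Lemma double_add_lt m n (b b' : bool) : (m < n)%N -> (m.*2 + b < n.*2 + b')%N.
Proof.
rewrite -leq_double doubleS => h; apply: leq_trans (leq_addr _ _).
by apply: leq_trans h; rewrite ltnS -addn1 leq_add2l; case: b.
Qed.

Section NIP.
Variables (L : language) (M : structure L) (K : Type).
Hypothesis mon : monster M K.
Hypothesis T_NIP : NIP M.

Let K_nat := monster_nat mon.
Let K_lim X := @monster_limit _ _ _ X mon.
Let smallU B C := @small_setU K K_nat K_lim M B C.
Let small_tagn Y := @small_tagged K K_nat K_lim nat Y K_nat.

(** If all the choices of one term in each pair look alike, then conjugating the
    point that separates the pairs shatters the sequence. *)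
Lemma nip_alternation (B : set M) X Y (D : set (X + Y -> M)) (x : X -> M)
    (u v : nat -> Y -> M) :
  small_set K B -> small K Y -> definable B D ->
  (forall i, D (tcat x (u i))) -> (forall i, ~ D (tcat x (v i))) ->
  (forall s : set nat,
     eqtp B (concat (fun i => if pselect (s i) then u i else v i)) (concat u)) ->
  False.
Proof.
move=> sB sY dD Du Dv suv.
have ht (s : set nat) : exists t, aut_over B t /\
    forall i, t \o (if pselect (s i) then u i else v i) = u i.
  have [t ht tE] := homogeneity mon sB (small_tagn sY) (suv s).
  exists t; split=> // i; apply: funext => y.
  exact: (congr1 (@^~ (Tagged (fun=> Y) (i := i) y)) tE).
have [t tE] := choice ht.
have key i s : D (tcat (t s \o x) (u i)) <-> s i.
  rewrite -{1}((tE s).2 i) -tcat_map (definable_aut _ (tE s).1 dD).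
  by case: pselect => h; split=> // h'; [exact: Du|case: (Dv i)].
have [W [phi [e [_ DE]]]] := dD.
pose g (w : (X + Y) + W) : X + (Y + W) := match w with
  | inl (inl x) => inl x | inl (inr y) => inr (inl y) | inr w => inr (inr w) end.
have [n [h [psi psiE]]] := parameter_support (rename g phi).
pose g' (w : X + 'I_n) : 'I_n + X := match w with inl x => inr x | inr i => inl i end.
have [m [h' [chi chiE]]] := parameter_support (rename g' psi).
apply: (@T_NIP n m chi).
exists (fun i => tcat (u i) e \o h), (fun s => (t s \o x) \o h') => i s.
rewrite -chiE sat_rename.
rewrite (_ : _ \o g' = tcat (t s \o x) (tcat (u i) e \o h)); last first.
  by apply: funext => -[].
rewrite -psiE sat_rename -key DE /=.
by rewrite (_ : _ \o g = tcat (tcat (t s \o x) (u i)) e) //; apply: funext => -[[]|].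
Qed.

Variable A : set M.
Hypothesis A_small : small_set K A.

(** If a formula over [a] told two terms apart, then some point would tell apart
    the members of all the pairs [c (2 m)], [c (2 m + 1)] at once, because [a] is free
    from the sequence. This contradicts NIP. *)
Lemma nonforking_constant X Y Z (a : X -> M) (c : nat -> Y -> M) (d : Z -> M) :
  small K Y -> small K Z ->
  indiscernible (A `|` range d) c -> nonforking A a (range (tcat (concat c) d)) ->
  forall i j, eqtp (A `|` range d `|` range a) (c i) (c j).
Proof.
move=> sY sZ cAd nf.
have pairs (f g : bool -> nat) : (f false < f true)%N -> (g false < g true)%N ->
    eqtp (A `|` range d) (tcat (c (f false)) (c (f true))) (tcat (c (g false)) (c (g true))).
  move=> hf hg.
  have := similar_pattern cAd (F := bool) (f := f) (g := g).
  have fg x y : (f x < f y)%O = (g x < g y)%O.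
    have lf : (f false < f true)%O := hf; have lg : (g false < g true)%O := hg.
    by case: x; case: y; rewrite ?ltxx ?lf ?lg // !ltNge !ltW.
  move=> /(_ fg) e.
  pose h (u : Y + Y) : {b : bool & Y} := match u with
    | inl y => Tagged (fun=> Y) (i := false) y | inr y => Tagged (fun=> Y) (i := true) y end.
  have := eqtp_reindex h e.
  rewrite (_ : _ \o h = tcat (c (f false)) (c (f true))); last by apply: funext => -[].
  by rewrite (_ : _ \o h = tcat (c (g false)) (c (g true))) //; apply: funext => -[].
have lt_case i j : (i < j)%N -> eqtp (A `|` range d `|` range a) (c i) (c j).
  move=> ij; apply/eqtpP => D /definable_split[D0 dD0 ->] Di; apply: contrapT => Dj.
  have [D1 dD1 D0E] := definable_split dD0.
  pose T := (X + (Y + Y + Z))%type.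
  pose h0 (u : Y + X + Z) : T := match u with
    | inl (inl y) => inr (inl (inl y)) | inl (inr x) => inl x | inr z => inr (inr z) end.
  pose h1 (u : Y + X + Z) : T := match u with
    | inl (inl y) => inr (inl (inr y)) | inl (inr x) => inl x | inr z => inr (inr z) end.
  pose E : set (T -> M) := [set w : T -> M | D1 (w \o h0) /\ ~ D1 (w \o h1)].
  have dE : definable A E.
    apply: definable_and; last apply: definable_not; exact: definable_reindex.
  have EE x y y' : E (tcat x (tcat (tcat y y') d)) <->
      D0 (tcat y x) /\ ~ D0 (tcat y' x).
    rewrite /E D0E /= (_ : _ \o h0 = tcat (tcat y x) d); last by apply: funext => -[[]|].
    by rewrite (_ : _ \o h1 = tcat (tcat y' x) d) //; apply: funext => -[[]|].
  pose c' m := tcat (tcat (c m.*2) (c m.*2.+1)) d.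
  have [|||||x hx] := @nonforking_consistent _ _ A _ _ a (tcat (tcat (c i) (c j)) d) c' E.
  - apply: nonforking_sub nf => _ [[[y|y]|z] _ <-].
    + by exists (inl (Tagged (fun=> Y) (i := i) y)).
    + by exists (inl (Tagged (fun=> Y) (i := j) y)).
    + by exists (inr z).
  - apply: indiscernible_const => n p q hp hq.
    pose f (r : 'I_n -> nat) (u : 'I_n * bool) := ((r u.1).*2 + u.2)%N.
    have := similar_pattern cAd (F := ('I_n * bool)%type) (f := f p) (g := f q).
    have fE (r : 'I_n -> nat) x y : {homo r : p q / (p < q)%N >-> (p < q)%O} ->
        (f r x < f r y)%O = (x.1 < y.1)%N || (x.1 == y.1) && (x.2 < y.2)%N.
      move=> hr; rewrite ltEnat /f.
      have [xy|yx|exy] := ltngtP x.1 y.1.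
      + have := hr _ _ xy; rewrite ltEnat /= => h; by rewrite double_add_lt.
      + have := hr _ _ yx; rewrite ltEnat /= => h.
        rewrite (_ : (x.1 == y.1) = false) /=; last first.
          by apply/eqP => e; rewrite e ltnn in yx.
        by apply/negbTE; rewrite -leqNgt ltnW // double_add_lt.
      + rewrite (val_inj exy) eqxx /= ltn_add2l.
        by case: (x.2) (y.2) => -[].
    move=> /(_ (fun x y => etrans (fE p x y hp) (esym (fE q x y hq)))) e.
    pose h (u : {p : 'I_n & (Y + Y)%type}) : {u : 'I_n * bool & Y} := match tagged u with
      | inl y => Tagged (fun=> Y) (i := (tag u, false)) y
      | inr y => Tagged (fun=> Y) (i := (tag u, true)) y end.
    have := eqtp_reindex h e.
    have hE (r : 'I_n -> nat) : concat (fun x => c (f r x)) \o h =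
        concat (fun k => tcat (c (r k).*2) (c (r k).*2.+1)).
      by apply: funext => -[k [y|y]]; rewrite /concat /= /f ?addn0 ?addn1.
    by rewrite !hE.
  - apply: tcat_eqtp; exact: (pairs (fun b => b : nat) (fun b => if b then j else i)).
  - exact: dE.
  - by apply/EE.
  have {}hx m : D0 (tcat (c m.*2) x) /\ ~ D0 (tcat (c m.*2.+1) x).
    exact: (EE _ _ _).1 (hx m).
  pose sw (u : Y + X) : X + Y := match u with inl y => inr y | inr x => inl x end.
  have swE (y : Y -> M) : tcat x y \o sw = tcat y x by apply: funext => -[].
  apply: (@nip_alternation (A `|` range d) X Y [set w : X + Y -> M | D0 (w \o sw)] x
    (fun m => c m.*2) (fun m => c m.*2.+1)) => //.
  - by apply: smallU => //; apply: small_range.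
  - exact: definable_reindex.
  - by move=> m; rewrite /= swE; case: (hx m).
  - by move=> m; rewrite /= swE; case: (hx m).
  - move=> s; pose f m := (m.*2 + ~~ `[< s m >])%N.
    rewrite (_ : concat _ = concat (fun m => c (f m))); last first.
      apply: funext => -[m y]; rewrite /concat /f /=.
      by case: pselect => h; [rewrite asboolT // addn0|rewrite asboolF // addn1].
    apply: (similar_pattern cAd (F := nat) (f := f) (g := double)) => x' y'.
    rewrite !ltEnat /= ltn_double /f; have [xy|yx|->] := ltngtP x' y'.
    + exact: double_add_lt.
    + by apply/negbTE; rewrite -leqNgt ltnW // double_add_lt.
    + by rewrite ltnn.
move=> i j; have [ij|ji|->] := ltngtP i j; [exact: lt_case| |by []].
exact/eqtp_sym/lt_case.
Qed.

End NIP.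

(** * Free witnesses of dividing *)

Lemma sequence_by_history T (P : seq T -> T -> Prop) : (forall s, exists x, P s x) ->
  exists f : nat -> T, forall n, P (mkseq f n) (f n).
Proof.
move=> hP; pose g s := projT1 (choice hP) s; have gP := projT2 (choice hP).
pose h := fix h n := if n is n'.+1 then rcons (h n') (g (h n')) else [::].
exists (fun n => g (h n)) => n.
suff -> : mkseq (fun n => g (h n)) n = h n by exact: gP.
by elim: n => //= n IH; rewrite mkseqS IH.
Qed.

Section Morley.
Variables (L : language) (M : structure L) (K : Type).
Hypothesis mon : monster M K.
Hypothesis T_NIP : NIP M.
Variable A : set M.
Hypothesis A_small : small_set K A.
Hypothesis A_base : extension_base K A.
Hypothesis A_trivial : left_totally_trivial K A.

Let K_nat := monster_nat mon.
Let K_lim X := @monster_limit _ _ _ X mon.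
Let smallU B C := @small_setU K K_nat K_lim M B C.
Let small_tagn Y := @small_tagged K K_nat K_lim nat Y K_nat.
Let nat_K := small_injects K_nat.
Let entries X Y := @nonforking_entries _ _ _ mon A A_small A_base A_trivial X Y.

Lemma eqtp_similar d d' (I : orderType d) (J : orderType d') Y (c c' : J -> Y -> M)
    (a : I -> Y -> M) :
  similar A a c -> eqtp A (concat c) (concat c') -> similar A a c'.
Proof.
move=> ac e n i j hi hj; apply: eqtp_trans (ac _ _ _ hi hj) _.
exact: (eqtp_reindex (fun u : {p : 'I_n & Y} =>
  Tagged (fun=> Y) (i := j (tag u)) (tagged u)) e).
Qed.

Lemma inconsistent_eqtp (I : Type) X Y (D : set (X + Y -> M)) (c c' : I -> Y -> M) :
  small K {i : I & Y} -> definable A D -> eqtp A (concat c) (concat c') ->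
  (exists x, forall i, D (tcat x (c i))) -> exists x, forall i, D (tcat x (c' i)).
Proof.
move=> sIY dD e [x hx]; have [s hs sE] := homogeneity mon A_small sIY e.
exists (s \o x) => i; have := hx i; rewrite -(definable_aut _ hs dD).
rewrite tcat_map (_ : s \o c i = c' i) //; apply: funext => y.
exact: (congr1 (@^~ (Tagged (fun=> Y) (i := i) y)) sE).
Qed.

(** Extract an indiscernible sequence from a nonforking extension of the type of
    [c]. Freeness survives the extraction since it concerns single entries. *)
Lemma free_copy Y Z (c : nat -> Y -> M) (h : Z -> M) : small K Y -> small K Z ->
  indiscernible A c ->
  exists e : nat -> Y -> M, [/\ similar A c e, indiscernible (A `|` range h) e &
    forall n y, nonforking A (fun _ : unit => e n y) (range h)].
Proof.
move=> sY sZ cA; have sh : small_set K (range h) by exact: small_range.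
have [a [ca nfa]] :=
  nonforking_extension mon A_small A_base (concat c) (small_tagn sY) sh.
pose r n y := a (Tagged (fun=> Y) (i := n) y).
have ra : concat r = a by apply: funext => -[].
have cr : similar A c r.
  by apply: (eqtp_similar (c := c)); rewrite ?ra //; exact/indiscernible_similar.
have [e [eh eE]] := @stretch_sequence _ _ _ mon (A `|` range h) Y _ nat r
  (smallU A_small sh) sY nat_K.
exists e; split=> //.
  move=> n i j hi hj; apply/eqtpP => D dD Di.
  have dD' := definable_reindex (fun u : {p : 'I_n & Y} => (j (tag u), tagged u)) dD.
  apply: (eE (codom j) _ (definable_sub (@subsetUl _ A (range h)) dD')) => t ht /=.
  apply: (eqtpP _ _ _).1 (cr n i (t \o j) hi _) _ dD Di => p q pq.
  by apply: ht; rewrite ?codom_f //; apply: hj.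
move=> n y; apply: (nonforkingI mon) => //; first exact: small_unit.
move=> D dD De fD.
have dD' := definable_reindex (fun _ : unit => (n, y)) (definable_not dD).
apply: (eE [::] _ dD') De => t _ /= Dr.
have nf1 : nonforking A (fun _ : unit => r (t n) y) (range h).
  exact: (nonforking_reindex mon A_small
    (f := fun _ : unit => Tagged (fun=> Y) (i := t n) y) (small_unit K_nat) sh nfa).
exact: (nonforkingE nf1 dD Dr fD).
Qed.

(** Rows: copies of a sequence that witnesses dividing, each free from the
    earlier ones. By NIP the rows are mutually homogeneous, so that an inconsistent
    row forces the columns to be inconsistent. *)
Lemma free_dividing X Y (D : set (X + Y -> M)) (b : Y -> M) :
  small K X -> small K Y -> definable A D -> dividing A D b ->
  exists d : nat -> Y -> M, [/\ indiscernible A d, d 0%N = b,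
    ~ exists x, forall i, D (tcat x (d i)) &
    forall i j, (i < j)%N -> nonforking A (d j) (range (d i))].
Proof.
move=> sX sY dD [c [cA cb ninc]].
pose hist (s : seq (nat -> Y -> M)) (u : 'I_(size s) * (nat * Y)) : M :=
  nth c s u.1 u.2.1 u.2.2.
have s_hist (s : seq (nat -> Y -> M)) : small K ('I_(size s) * (nat * Y)).
  apply: small_prod => //; first exact: small_ord.
  exact: small_prod.
have [R hR] := sequence_by_history (fun s => free_copy (hist s) sY (s_hist s) cA).
have histE n i k y : (i < n)%N -> range (hist (mkseq R n)) (R i k y).
  move=> ni; have ni' : (i < size (mkseq R n))%N by rewrite size_mkseq.
  by exists (Ordinal ni', (k, y)) => //; rewrite /hist /= nth_mkseq.
have cR j : similar A c (R j) by case: (hR j).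
have free i j k l y : (i < j)%N ->
    nonforking A (fun _ : unit => R j k y) (range (R i l)).
  move=> ij; have [_ _ /(_ k y)] := hR j; apply: nonforking_sub => _ [z _ <-].
  exact: histE.
have rows s k l : eqtp (A `|` \bigcup_(t in [set t | t <> s]) range (concat (R t)))
    (R s k) (R s l).
  pose Z := ({t | (s < t)%N} * (nat * Y))%type.
  pose a (u : Z) := R (sval u.1) u.2.1 u.2.2.
  have sZ : small K Z.
    apply: small_prod => //; last exact: small_prod.
    by apply: small_sub K_nat; exists sval; exact: sval_inj.
  have [_ Rs _] := hR s.
  have sWs : small K ({p : nat & Y} + 'I_(size (mkseq R s)) * (nat * Y)).
    by apply: small_sum => //; exact: small_tagn.
  have nfa : nonforking A a (range (tcat (concat (R s)) (hist (mkseq R s)))).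
    apply: entries => // -[[t st] [m y]] /=.
    have [_ _ /(_ m y)] := hR t; apply: nonforking_sub => _ [[[p z]|[[i /= hi] [p z]]] _ <-].
      exact: histE.
    have hi' : (i < s)%N by rewrite -(size_mkseq R s).
    rewrite /hist /= nth_mkseq //.
    by apply: histE; exact: ltn_trans st.
  apply: eqtp_sub (nonforking_constant mon T_NIP A_small sY (s_hist _) Rs nfa k l).
  move=> x [Ax|[t /= ts [[p y] _ <-]]]; first by left; left.
  have [st|lt_ts|st] := ltngtP s t; last by case: ts.
    by right; exists (exist _ t st, (p, y)).
  by left; right; exact: histE.
have paths := paths_eqtp rows.
have sT : small K {p : nat & Y} by exact: small_tagn.
have [e [eA eE]] := @stretch_sequence _ _ _ mon A _ _ nat (fun j => concat (R j))
  A_small sT nat_K.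
pose R' j k y := e j (Tagged (fun=> Y) (i := k) y).
have eR j : concat (R' j) = e j by apply: funext => -[].
have cR' j : eqtp A (concat c) (concat (R' j)).
  rewrite eR; apply/eqtpP => E dE Ec.
  apply: (eE [::] _ (definable_reindex (fun u => (j, u)) dE)) => t _ /=.
  exact: (eqtpP _ _ _).1 (similar_eqtp (cR (t j))) _ dE Ec.
(* The new rows satisfy what holds of old rows with increasing indices [t]; the
   path [q] is transported along [t]. *)
have paths' (q : nat -> nat) :
    eqtp A (concat (fun j => R' j (q j))) (concat (fun j => R' j 0%N)).
  apply/eqtp_sym/eqtpP => E /definable_support[F [f [E' [dE' ->]]]].
  pose g (p : nat -> nat) (x : F) : nat * {p : nat & Y} :=
    (tag (f x), Tagged (fun=> Y) (i := p (tag (f x))) (tagged (f x))).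
  apply: (eE (codom (fun x => tag (f x)))
    [set v : nat * {p : nat & Y} -> M | E' (v \o g (fun=> 0%N)) -> E' (v \o g q)]).
    by apply: definable_imp; exact: definable_reindex.
  move=> t ht /=.
  have tI x y : t (tag (f x)) = t (tag (f y)) -> tag (f x) = tag (f y).
    move=> txy; have h u v : (tag (f u) < tag (f v))%N -> (t (tag (f u)) < t (tag (f v)))%N.
      by move=> uv; apply: ht => //; rewrite (codom_f (fun x => tag (f x))).
    have [xy|yx|//] := ltngtP (tag (f x)) (tag (f y)).
      by have := h _ _ xy; rewrite txy ltnn.
    by have := h _ _ yx; rewrite txy ltnn.
  have [q' qE] : exists q', forall x, q' (t (tag (f x))) = q (tag (f x)).
    have hq m : exists k, forall x, t (tag (f x)) = m -> k = q (tag (f x)).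
      have [[x xm]|n] := pselect (exists x, t (tag (f x)) = m); last first.
        by exists 0%N => x xm; case: n; exists x.
      by exists (q (tag (f x))) => y ym; rewrite (tI x y) // xm.
    have [q' hq'] := choice hq; exists q' => x; exact: hq'.
  have := eqtp_iff (paths (fun=> 0%N) q') (definable_reindex
    (fun x => Tagged (fun=> Y) (i := t (tag (f x))) (tagged (f x))) dE').
  rewrite /= (_ : _ \o _ = (fun p => concat (R (t p.1)) p.2) \o g (fun=> 0%N)) //.
  rewrite (_ : concat (fun s => R s (q' s)) \o _ = (fun p => concat (R (t p.1)) p.2) \o g q).
    by move=> h /h.
  by apply: funext => x; rewrite /concat /= qE.
have col j : eqtp A (R' j 0%N) b.
  apply: eqtp_trans (cb 0%N); apply: eqtp_sym.
  exact: (eqtp_reindex (fun y => Tagged (fun=> Y) (i := 0%N) y) (cR' j)).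
have [s hs sE] := homogeneity mon A_small sY (col 0%N).
pose top (y : Y) : {p : nat & Y} := Tagged (fun=> Y) (i := 0%N) y.
exists (fun j => s \o R' j 0%N); split=> //.
- apply: indiscernible_aut_over => //.
  exact: (indiscernible_reindex top eA).
- move=> incd.
  have [x hx] : exists x, forall i, D (tcat x (R' i 0%N)).
    apply: inconsistent_eqtp incd => //.
    exact: eqtp_sym (aut_eqtp _ hs).
  have bad j : exists k, ~ D (tcat x (R' j k)).
    apply: contrapT => n; apply: ninc.
    apply: (inconsistent_eqtp sT dD (eqtp_sym (cR' j))); exists x => k.
    by apply: contrapT => nD; apply: n; exists k.
  have [k hk] := choice bad.
  apply: (nip_alternation mon T_NIP A_small sY dD hx hk) => S.
  have := paths' (fun j => if pselect (S j) then 0%N else k j).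
  rewrite (_ : (fun j => R' j _) = fun j => if pselect (S j) then R' j 0%N else R' j (k j)) //.
  by apply: funext => j; case: pselect.
- move=> i j ij; rewrite -aut_range; apply: (nonforking_aut mon) => //.
    exact: small_range.
  apply: (@nonforking_stretch _ _ _ mon A A_small A _ _ _ _ _ (fun j => concat (R j)) e j i top top) => //.
  + move=> m; apply: eqtp_trans (eqtp_trans (cb 0%N) (eqtp_sym (col i))).
    exact: (eqtp_sym (similar1 0%N 0%N (cR m))).
  + move=> t ht; apply: entries => // y; apply: free; apply: ht; rewrite ?inE ?eqxx ?orbT //.
Qed.

End Morley.

(** * Strictly nonforking sequences *)

Section Broom.
Variables (L : language) (M : structure L) (K : Type).
Hypothesis mon : monster M K.
Hypothesis T_NIP : NIP M.
Variable A : set M.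
Hypothesis A_small : small_set K A.
Hypothesis A_base : extension_base K A.
Hypothesis A_trivial : left_totally_trivial K A.

Let K_nat := monster_nat mon.
Let K_lim X := @monster_limit _ _ _ X mon.
Let smallU B C := @small_setU K K_nat K_lim M B C.
Let small_tagp S Y := @small_tagged K K_nat K_lim S Y.
Let nat_K := small_injects K_nat.
Let entries X Y := @nonforking_entries _ _ _ mon A A_small A_base A_trivial X Y.

Lemma finite_inconsistent X Y (D : set (X + Y -> M)) (c : nat -> Y -> M) :
  small K X -> small K Y -> definable A D ->
  ~ (exists x, forall i, D (tcat x (c i))) ->
  exists n, ~ exists x, forall i, (i < n)%N -> D (tcat x (c i)).
Proof.
move=> sX sY dD ninc; apply: contrapT => nn; apply: ninc.
pose S n : set (X -> M) := [set x | forall i, (i < n)%N -> D (tcat x (c i))].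
pose fam : set (set (X -> M)) := [set Q | exists n, Q = S n].
have [|||||x hx] := @compactness _ _ _ mon _ (A `|` range (concat c)) fam.
- exact: small_injects.
- by apply: smallU => //; apply: small_range; exact: small_tagp.
- by exists (S 0%N), 0%N.
- by move=> _ [n ->]; apply: contrapT => n'; apply: nn; exists n.
- move=> _ _ [n ->] [m ->]; exists (S (maxn n m)); first by exists (maxn n m).
  by move=> x h; split=> i hi; apply: h; rewrite leq_max hi ?orbT.
exists x => i; apply: (hx (S i.+1) [set x | D (tcat x (c i))]).
- by exists i.+1.
- apply: definable_fix; last by apply: definable_sub dD => y; left.
  by move=> _ [y _ <-]; right; exists (Tagged (fun=> Y) (i := i) y).
- by move=> y; apply.
Qed.

Section Covers.
Variables (X : Type) (D : set (X -> M)).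
Hypothesis X_small : small K X.

(** The partial type of all conjugates of [D] over [A] implies [Th]. *)
Definition conjugates_imply (Th : set (X -> M)) : Prop :=
  exists (T : Type) (s : T -> M -> M), [/\ small K T, forall t, aut_over A (s t) &
    forall x, (forall t, D (s t \o x)) -> Th x].

Lemma conjugates_imply_sub (Th Th' : set (X -> M)) : Th `<=` Th' ->
  conjugates_imply Th -> conjugates_imply Th'.
Proof. by move=> sub [T [s [h1 h2 h3]]]; exists T, s; split=> // x /h3/sub. Qed.

Lemma conjugates_imply_and (Th Th' : set (X -> M)) :
  conjugates_imply Th -> conjugates_imply Th' ->
  conjugates_imply [set x | Th x /\ Th' x].
Proof.
move=> [T [s [h1 h2 h3]]] [T' [s' [h1' h2' h3']]].
exists (T + T')%type, (fun u => match u with inl t => s t | inr t => s' t end).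
split; [exact: small_sum|by case|move=> x h; split].
- by apply: h3 => t; exact: (h (inl t)).
- by apply: h3' => t; exact: (h (inr t)).
Qed.

Lemma conjugates_imply_prefix (Th : nat -> set (X -> M)) n :
  (forall m, conjugates_imply (Th m)) ->
  conjugates_imply [set x | forall m, (m < n)%N -> Th m x].
Proof.
move=> h; elim: n => [|n IH].
  exists void, (fun v : void => match v with end).
  by split=> [||x _ m]; [exact: small_void|case|rewrite ltn0].
apply: conjugates_imply_sub (conjugates_imply_and IH (h n)) => x [hl hn] m.
by rewrite ltnS leq_eqVlt => /predU1P[->|/hl].
Qed.

Lemma conjugates_imply_aut (Th : set (X -> M)) s : aut_over A s ->
  conjugates_imply Th -> conjugates_imply [set x | Th (s \o x)].
Proof.
move=> hs [T [r [h1 h2 h3]]]; exists T, (fun t => r t \o s); split=> //.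
  by move=> t; exact: aut_comp.
by move=> x h; apply: h3 => t; exact: h.
Qed.

(** The broom lemma. The set of all conjugates of [D] over [A] implies a disjunction
    of dividing formulas [E t] at [b], and the disjuncts are removed from the last
    on. Let [d] be a conjugate of [b] from which the other parameters [e] in play are
    free. A free sequence that starts at [d], is indiscernible over [e] and witnesses
    that [E t] divides replaces the formulas [E 0], ..., [E t] at [d] by the formulas
    [E 0], ..., [E (t - 1)] at the first [n] terms. Each of these terms can then be
    dealt with in the same way, since the later terms are free from it and so, by
    total triviality, are the later terms together with [e]. *)
Theorem forking_conjugates : forking A D ->
  exists (T : Type) (s : T -> M -> M), [/\ small K T, forall t, aut_over A (s t) &
    ~ exists x, forall t, D (s t \o x)].
Proof.
move=> fD; have [Y [b [k [E [dE divE DE]]]]] := forking_common mon A_small X_small fD.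
have sY : small K Y by exact: small_finType.
pose Dr (r : nat) (d : Y -> M) : set (X -> M) :=
  [set x | exists2 t : 'I_k, (t < r)%N & E t (tcat x d)].
(* [Th] is the disjunction of the formulas at the other parameters. *)
suff claim r : forall Z (e : Z -> M) (d : Y -> M) (Th : set (X -> M)), small K Z ->
    eqtp A b d -> nonforking A e (range d) ->
    (forall s, aut_over (A `|` range e) s -> forall x, Th x -> Th (s \o x)) ->
    conjugates_imply [set x | Dr r d x \/ Th x] -> conjugates_imply Th.
  have [|||||T [s [h1 h2 h3]]] := @claim k void (of_void M) b [set _ | False].
  - exact: small_void.
  - by [].
  - by apply: (nonforking_empty mon A_small A_base) => //; apply: small_range.
  - by [].
  - exists unit, (fun=> id); split; [exact: small_unit|by move=> _; exact: aut_id|].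
    by move=> x /(_ tt)/DE[t ht]; left; exists t.
  by exists T, s; split=> // -[x hx]; exact: (h3 x hx).
elim: r => [|r IH] Z e d Th sZ bd nf inv.
  by apply: conjugates_imply_sub => x [[]|].
have [rk|kr] := ltnP r k; last first.
  move=> h; apply: (IH _ e d Th sZ bd nf inv); apply: conjugates_imply_sub h => x.
  move=> [[t _ ht]|]; last by right.
  by left; exists t => //; exact: leq_trans kr.
move=> imp; pose tr : 'I_k := Ordinal rk.
have divd : dividing A (E tr) d.
  by have [c [cA cb ninc]] := divE tr; exists c; split=> // i; exact: eqtp_trans bd.
have [c0 [c0A c00 ninc0 free0]] := free_dividing mon T_NIP A_small A_base A_trivial
  X_small sY (dE tr) divd.
have [c [ce cd cc]] := indiscernible_over mon A_small sZ sY nf c0A c00.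
have snY : small K {p : nat & Y} by exact: small_tagp.
have ninc : ~ exists x, forall i, E tr (tcat x (c i)).
  by move=> h; apply: ninc0;
     apply: (inconsistent_eqtp mon A_small snY (dE tr) (eqtp_sym (similar_eqtp cc))).
have free i j : (i < j)%N -> nonforking A (c j) (range (c i)).
  move=> ij; apply: (nonforking_eqtp mon A_small sY sY _ (free0 i j ij)).
  pose h (u : Y + Y) : {p : nat & Y} := match u with
    | inl y => Tagged (fun=> Y) (i := j) y | inr y => Tagged (fun=> Y) (i := i) y end.
  have := eqtp_reindex h (similar_eqtp cc).
  rewrite (_ : _ \o h = tcat (c0 j) (c0 i)); last by apply: funext => -[].
  by rewrite (_ : _ \o h = tcat (c j) (c i)) //; apply: funext => -[].
have dc m : eqtp (A `|` range e) d (c m) by rewrite -cd; exact: similar1.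
have sAe : small_set K (A `|` range e) by apply: smallU => //; exact: small_range.
have nfm m : nonforking A e (range (c m)).
  apply: (nonforking_eqtp mon A_small sZ sY _ nf).
  pose h (u : Z + Y) : Y + Z := match u with inl z => inr z | inr y => inl y end.
  have := eqtp_reindex h (tcat_eqtp (dc m)).
  rewrite (_ : _ \o h = tcat e d); last by apply: funext => -[].
  by rewrite (_ : _ \o h = tcat e (c m)) //; apply: funext => -[].
have impm m : conjugates_imply [set x | Dr r.+1 (c m) x \/ Th x].
  have [s hs sE] := homogeneity mon sAe sY (dc m).
  have [s' [hs' ss' s's]] := aut_inv hs.
  have subA : A `<=` A `|` range e by move=> x; left.
  apply: conjugates_imply_sub (conjugates_imply_aut (aut_sub subA hs') imp) => x /=.
  have sx : s \o (s' \o x) = x by apply: funext => z /=; rewrite s's.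
  move=> [[t tr' Et]|/(inv _ hs)]; last by rewrite sx; right.
  left; exists t => //; move: Et.
  by rewrite -(definable_aut _ (aut_sub subA hs) (dE t)) tcat_map sx sE.
have [n hn] := finite_inconsistent X_small sY (dE tr) ninc.
have start : conjugates_imply [set x | (exists m, (0 <= m < n)%N /\ Dr r (c m) x) \/ Th x].
  apply: conjugates_imply_sub (@conjugates_imply_prefix _ n impm) => x hx.
  apply: contrapT => nx; apply: hn; exists x => m mn.
  have [[t tr' Et]|Thx] := hx m mn; last by case: nx; right.
  move: tr'; rewrite ltnS leq_eqVlt => /predU1P[tr'|tr'].
    by rewrite (_ : tr = t) //; apply: val_inj.
  by case: nx; left; exists m; split=> //; exists t.
have step j : (j <= n)%N ->
    conjugates_imply [set x | (exists m, (j <= m < n)%N /\ Dr r (c m) x) \/ Th x].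
  elim: j => [//|j IHj] jn; have {IHj} := IHj (ltnW jn).
  pose later (u : {p : nat & Y}) := c (j + (tag u).+1)%N (tagged u).
  move=> h; apply: (IH _ (tcat e later) (c j)) => //.
  - exact: small_sum.
  - apply: eqtp_trans bd _; apply: eqtp_sub (dc j) => x; exact: or_introl.
  - apply: A_trivial => //; apply: entries => // -[p y].
    apply: (nonforking_reindex mon A_small (f := fun _ : unit => y)) => //.
    + exact: small_unit.
    + exact: small_range.
    + by apply: free; rewrite addnS ltnS leq_addr.
  - move=> s hs x [[m [jm [t tr' Et]]]|Thx].
      left; exists m; split=> //; exists t => //.
      have sc : s \o c m = c m.
        apply: funext => y /=; apply: hs.2; right.
        exists (inr (Tagged (fun=> Y) (i := (m - j.+1)%N) y)) => //.
        by rewrite /= /later /= addnS -addSn subnKC //; case/andP: jm.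
      have subA : A `<=` A `|` range (tcat e later) by move=> z; left.
      by rewrite -sc -tcat_map (definable_aut _ (aut_sub subA hs) (dE t)).
    right; apply: inv Thx; apply: aut_sub hs => z [|[w _ <-]]; first by left.
    by right; exists (inl w).
  - apply: conjugates_imply_sub h => x [[m [/andP[jm mn] Drx]]|]; last by right; right.
    move: jm; rewrite leq_eqVlt => /predU1P[->|jm]; first by left.
    by right; left; exists m; rewrite jm mn.
apply: conjugates_imply_sub (step n (leqnn n)) => x [[m [/andP[h1 h2]]]|//].
by move: (leq_ltn_trans h1 h2); rewrite ltnn.
Qed.

End Covers.

(** If a formula [F(z, b)] forks, then [F(c, _)] cannot hold of all the members of a
    family of conjugates of [b] along which [F] is inconsistent. By [A_base] such a
    family can be chosen free from [c], so one of its members is as required for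
    [F]. *)
Lemma strict_extension Y Z (b : Y -> M) (c : Z -> M) : small K Y -> small K Z ->
  exists b', [/\ eqtp A b b', nonforking A b' (range c) & nonforking A c (range b')].
Proof.
move=> sY sZ; have sc : small_set K (range c) by exact: small_range.
pose fam : set (set (Y -> M)) := [set Q | exists D E (F : set (Z + Y -> M)),
  [/\ definable A D /\ D b, definable (A `|` range c) E /\ forking A E,
      definable A F /\ forking A [set z | F (tcat z b)] &
      Q = [set y | [/\ D y, ~ E y & ~ F (tcat c y)]]]].
have [|||||b' hb'] := @compactness _ _ _ mon _ (A `|` range c) fam.
- exact: small_injects.
- exact: smallU.
- exists [set y | [/\ True, ~ False & ~ False]], [set _ | True], [set _ | False], [set _ | False].
  split=> //; split=> //; by [exact: definable_true|exact: definable_false|exact: forking_false].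
- move=> _ [D [E [F [[dD Db] [dE fE] [dF fF] ->]]]].
  have [T [s [sT hs ns]]] := forking_conjugates sZ fF.
  have hr t := aut_inv (hs t).
  have [r hr'] := choice hr.
  have sTY : small K {t : T & Y} by exact: small_tagp.
  have [a [ra nfa]] := nonforking_extension mon A_small A_base
    (concat (fun t => r t \o b)) sTY sc.
  have [q hq qE] := homogeneity mon A_small sTY ra.
  have [q' [hq' qq' q'q]] := aut_inv hq.
  have [t nt] : exists t, ~ F (tcat (s t \o (q' \o c)) b).
    by apply: contrapT => n; apply: ns; exists (q' \o c) => t; apply: contrapT => nF; apply: n; exists t.
  pose at_t (y : Y) : {t : T & Y} := Tagged (fun=> Y) (i := t) y.
  have aE : a \o at_t = q \o (r t \o b) by rewrite -qE.
  exists (a \o at_t); split.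
  + have [hrt _ _] := hr' t.
    by rewrite aE (definable_aut _ hq dD) (definable_aut _ hrt dD).
  + move=> Ea; have nf1 := nonforking_reindex mon A_small (f := at_t) sY sc nfa.
    exact: (nonforkingE nf1 dE Ea fE).
  + move=> Fa; apply: nt; move: Fa.
    rewrite -(definable_aut _ hq' dF) tcat_map aE.
    rewrite -(definable_aut _ (hs t) dF) tcat_map.
    rewrite (_ : s t \o (q' \o (q \o (r t \o b))) = b) //.
    by apply: funext => y /=; have [_ _ rs] := hr' t; rewrite qq' rs.
- move=> _ _ [D [E [F [[dD Db] [dE fE] [dF fF] ->]]]] [D' [E' [F' [[dD' Db'] [dE' fE'] [dF' fF'] ->]]]].
  exists [set y | [/\ D y /\ D' y, ~ (E y \/ E' y) & ~ (F (tcat c y) \/ F' (tcat c y))]].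
    exists [set y | D y /\ D' y], [set y | E y \/ E' y], [set u | F u \/ F' u]; split=> //.
    + by split=> //; exact: definable_and.
    + split; last exact: forking_or.
      exact: definable_or.
    + split; first exact: definable_or.
      exact: forking_or.
  by move=> y [[h1 h2] h3 h4]; split; split=> // h; by [apply: h3; left|apply: h4; left|apply: h3; right|apply: h4; right].
have bb' : eqtp A b b'.
  apply/eqtpP => D dD Db.
  apply: (hb' [set y | [/\ D y, ~ False & ~ False]] D); last by move=> y [].
    exists D, [set _ | False], [set _ | False].
    split=> //; split=> //; by [exact: definable_false|exact: forking_false].
  by apply: definable_sub dD => x; left.
exists b'; split=> //; apply: (nonforkingI mon A_small) => //.
- move=> E dE Eb' fE; have : [set y | ~ E y] b'; last by apply.
  apply: (hb' [set y | [/\ True, ~ E y & ~ False]]); last by move=> y [].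
    exists [set _ | True], E, [set _ | False].
    split=> //; split=> //; by [exact: definable_true|exact: definable_false|exact: forking_false].
  exact: definable_not.
- exact: small_range.
- move=> D /definable_split[F dF ->] Fc fF.
  have [s hs sE] := homogeneity mon A_small sY bb'.
  have fF' : forking A [set z | F (tcat z b)].
    apply: forking_sub (forking_aut hs fF) => z Fz /=.
    by rewrite -sE -tcat_map (definable_aut _ hs dF).
  have : [set y | ~ F (tcat c y)] b'; last by apply.
  apply: (hb' [set y | [/\ True, ~ False & ~ F (tcat c y)]]); last by move=> y [].
    exists [set _ | True], [set _ | False], F.
    split=> //; split=> //; by [exact: definable_true|exact: definable_false|exact: forking_false].
  pose h (u : Z + Y) : Y + Z := match u with inl z => inr z | inr y => inl y end.
  rewrite [X in definable _ X](_ : _ =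
     [set y : Y -> M | [set w : Y + Z -> M | ~ F (w \o h)] (tcat y c)]).
    apply: definable_fix; first by move=> x; right.
    apply: definable_not; apply: definable_reindex; apply: definable_sub dF => x; by left.
  have hE (y : Y -> M) : tcat y c \o h = tcat c y by apply: funext => -[].
  by apply/seteqP; split=> y /=; rewrite hE.
Qed.

Lemma strict_sequence Y (b : Y -> M) : small K Y ->
  exists e : nat -> Y -> M, [/\ indiscernible A e, forall i, eqtp A (e i) b &
    forall i j, i <> j -> nonforking A (e i) (range (e j))].
Proof.
move=> sY.
pose hist (s : seq (Y -> M)) (u : 'I_(size s) * Y) : M := nth b s u.1 u.2.
have s_hist (s : seq (Y -> M)) : small K ('I_(size s) * Y).
  by apply: small_prod => //; exact: small_ord.
have [R hR] := sequence_by_history (fun s => strict_extension b (hist s) sY (s_hist s)).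
have free i j : i <> j -> nonforking A (R i) (range (R j)).
  have [ij|ji|//] := ltngtP i j => _.
  - have [_ _ nf] := hR j.
    have ij' : (i < size (mkseq R j))%N by rewrite size_mkseq.
    rewrite (_ : R i = hist (mkseq R j) \o (fun y => (Ordinal ij', y))).
      by apply: (nonforking_reindex mon A_small) => //; exact: small_range.
    by apply: funext => y; rewrite /hist /= nth_mkseq.
  - have [_ + _] := hR i; apply: nonforking_sub => _ [y _ <-].
    have ji' : (j < size (mkseq R i))%N by rewrite size_mkseq.
    by exists (Ordinal ji', y) => //; rewrite /hist /= nth_mkseq.
have Rb i : eqtp A (R i) b by have [h _ _] := hR i.
have [e [eA eE]] := @stretch_sequence _ _ _ mon A Y _ nat R A_small sY nat_K.
have eb i : eqtp A (e i) b.
  apply/eqtp_sym/eqtpP => D dD Db.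
  apply: (eE [::] _ (definable_reindex (fun y => (i, y)) dD)) => t _ /=.
  exact: (eqtpP _ _ _).1 (eqtp_sym (Rb (t i))) _ dD Db.
exists e; split=> // i j ij.
apply: (@nonforking_stretch _ _ _ mon A A_small A _ _ _ _ _ R e i j id id) => //.
- by move=> k; exact: eqtp_trans (Rb k) (eqtp_sym (eb j)).
- move=> t ht; apply: free.
  have [lt_ij|lt_ji|//] := ltngtP i j.
    by have : (t i < t j)%N; [apply: ht => //; rewrite !inE eqxx ?orbT|move=> + e'; rewrite e' ltnn].
  by have : (t j < t i)%N; [apply: ht => //; rewrite !inE eqxx ?orbT|move=> + e'; rewrite e' ltnn].
Qed.

End Broom.

(** * Strict independence *)

Lemma lt_sigma_neq d d' (I : orderType d) (J : I -> orderType d') (x y : {i : I & J i}) :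
  tag x <> tag y -> (x < y)%O = (tag x < tag y)%O.
Proof. by move=> n; rewrite ltEsig; case: (ltgtP (tag x) (tag y)) => // e; case: (n e). Qed.

Lemma lt_sigma_eq d d' (I : orderType d) (J : I -> orderType d') (i : I) (x y : J i) :
  (Tagged J x < Tagged J y)%O = (x < y)%O.
Proof. exact: (@lt_Taggedl _ _ I J (Tagged J y) x). Qed.

Lemma homo_ltE n d (J : orderType d) (p : 'I_n -> J) :
  {homo p : x y / (x < y)%N >-> (x < y)%O} -> forall x y, (p x < p y)%O = (x < y)%N.
Proof.
move=> hp x y; have [xy|yx|exy] := ltngtP x y; first exact: hp.
  by apply/negbTE; rewrite -leNgt ltW // hp.
by rewrite (val_inj exy) ltxx.
Qed.

Section Strict.
Variables (L : language) (M : structure L) (K : Type).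
Hypothesis mon : monster M K.
Hypothesis T_NIP : NIP M.
Variable A : set M.
Hypothesis A_small : small_set K A.
Hypothesis A_base : extension_base K A.
Hypothesis A_trivial : left_totally_trivial K A.

Let K_nat := monster_nat mon.
Let K_lim X := @monster_limit _ _ _ X mon.
Let smallU B C := @small_setU K K_nat K_lim M B C.
Let small_tagp S Y := @small_tagged K K_nat K_lim S Y.
Let nat_K := small_injects K_nat.
Let entries X Y := @nonforking_entries _ _ _ mon A A_small A_base A_trivial X Y.

Lemma dividing_eqtp X Y (D : set (X + Y -> M)) (b b' : Y -> M) :
  eqtp A b b' -> dividing A D b -> dividing A D b'.
Proof.
move=> bb' [c [cA cb ninc]]; exists c; split=> // i.
exact: eqtp_trans (cb i) bb'.
Qed.

Section Independent.
Variables (d : Order.disp_t) (I : orderType d) (X : Type) (a : I -> X -> M).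
Hypotheses (I_small : small K I) (X_small : small K X).
Hypothesis a_free : forall i j, i <> j -> nonforking A (a i) (range (a j)).
Variables (d' : Order.disp_t) (J : I -> orderType d') (c : forall i, J i -> X -> M).
Hypotheses (J_infinite : forall i, infinite_set [set: J i])
  (c_indisc : forall i, indiscernible A (c (i := i))) (k : forall i, J i)
  (ck : forall i, c (k i) = a i).

(** One row is added at a time. The earlier rows consist of conjugates of the
    [a i] over the new term, so that they are free from it, by total triviality, and
    the new row can be chosen indiscernible over them. *)
Lemma finite_rows (l : seq I) : exists r : I -> nat -> X -> M,
  [/\ forall i, i \in l -> similar A (c (i := i)) (r i),
      forall i, i \notin l -> forall n, r i n = a i &
      forall p : I -> nat, eqtp A (concat a) (concat (fun i => r i (p i)))].
Proof.
elim: l => [|i0 l [r [rc ra rp]]]; first by exists (fun i _ => a i); split.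
have [il|il] := boolP (i0 \in l).
  exists r; split=> // i; first by rewrite inE => /predU1P[->|]; exact: rc.
  by rewrite inE negb_or => /andP[_]; exact: ra.
have [b cb] := nat_sequence mon A_small X_small (@J_infinite i0) (@c_indisc i0).
have b0a : eqtp A (b 0%N) (a i0) by rewrite -ck; apply/eqtp_sym; exact: similar1 cb.
have [s hs sE] := homogeneity mon A_small X_small b0a.
have cb' : similar A (c (i := i0)) (fun n => s \o b n).
  by apply: eqtp_similar cb _; exact: (aut_eqtp _ hs).
have bA : indiscernible A (fun n => s \o b n).
  exact: similar_indiscernible (@J_infinite i0) cb'.
pose Z := ({i | i <> i0} * (nat * X))%type.
pose e (u : Z) := r (sval u.1) u.2.1 u.2.2.
have sZ : small K Z.
  apply: small_prod => //; last exact: small_prod.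
  by apply: small_sub I_small; exists sval; exact: sval_inj.
have nfe : nonforking A e (range (a i0)).
  apply: entries => // -[[i ii0] [n x]] /=.
  have nfi : nonforking A (r i n) (range (a i0)).
    apply: (nonforking_eqtp mon A_small X_small X_small _ (a_free ii0)).
    pose h (u : X + X) : {i : I & X} := match u with
      | inl x => Tagged (fun=> X) (i := i) x | inr x => Tagged (fun=> X) (i := i0) x end.
    have := eqtp_reindex h (rp (fun=> n)).
    rewrite (_ : _ \o h = tcat (a i) (a i0)); last by apply: funext => -[].
    rewrite (_ : _ \o h = tcat (r i n) (a i0)) //.
    by apply: funext => -[] y //; rewrite -(ra _ il n).
  apply: (nonforking_reindex mon A_small (f := fun _ : unit => x)) nfi => //.
    exact: small_unit.
  exact: small_range.
have [c' [c'e c'0 bc']] := indiscernible_over mon A_small sZ X_small nfe bA sE.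
pose r' i := if pselect (i = i0) then c' else r i.
have r'0 : r' i0 = c' by rewrite /r'; case: pselect.
have r'n i : i <> i0 -> r' i = r i by rewrite /r'; case: pselect.
exists r'; split.
- move=> i; rewrite inE; have [->|ii0] := pselect (i = i0).
    move=> _; rewrite r'0; apply: similar_comp bc' => //; exact: infinite_nat.
  by move=> /predU1P[//|il']; rewrite r'n //; exact: rc.
- by move=> i; rewrite inE negb_or => /andP[/eqP ii0 il'] n; rewrite r'n // ra.
- move=> p; apply: eqtp_trans (rp p) _.
  pose h (u : {i : I & X}) : X + Z := match pselect (tag u = i0) with
    | left _ => inl (tagged u)
    | right n => inr (exist (fun i => i <> i0) (tag u) n, (p (tag u), tagged u)) end.
  have e0 : eqtp (A `|` range e) (c' 0%N) (c' (p i0)) by exact: similar1.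
  have := eqtp_reindex h (tcat_eqtp e0).
  rewrite (_ : _ \o h = concat (fun i => r i (p i))); last first.
    apply: funext => -[i x]; rewrite /h /concat /=; case: pselect => //= ->.
    by rewrite c'0 ra.
  rewrite (_ : _ \o h = concat (fun i => r' i (p i))) //.
  apply: funext => -[i x]; rewrite /h /concat /=; case: pselect => /= [->|n].
    by rewrite r'0.
  by rewrite r'n.
Qed.

Lemma infinite_rows : exists r : I -> nat -> X -> M,
  (forall i, similar A (c (i := i)) (r i)) /\
  (forall p : I -> nat, eqtp A (concat a) (concat (fun i => r i (p i)))).
Proof.
pose row (w : I * (nat * X) -> M) i n x := w (i, (n, x)).
pose S (l : seq I) : set (I * (nat * X) -> M) := [set w |
  (forall i, i \in l -> similar A (c (i := i)) (row w i)) /\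
  (forall p : I -> nat, eqtp A (concat a) (concat (fun i => row w i (p i))))].
pose fam : set (set (I * (nat * X) -> M)) := [set Q | exists l, Q = S l].
have [||||w hw] := @compactness _ _ _ mon _ A fam _ A_small.
- by apply: small_injects; apply: small_prod => //; exact: small_prod.
- by exists (S [::]), [::].
- move=> _ [l ->]; have [r [rc _ rp]] := finite_rows l.
  by exists (fun u => r u.1 u.2.1 u.2.2); split.
- move=> _ _ [l ->] [l' ->]; exists (S (l ++ l')); first by exists (l ++ l').
  by move=> w [h1 h2]; split; split=> // i il; apply: h1; rewrite mem_cat il ?orbT.
exists (row w); split=> [i n p q hp hq|p]; apply/eqtpP => D dD Dc.
- apply: (hw (S [:: i]) [set w | D (concat (fun x => row w i (q x)))]).
  + by exists [:: i].
  + exact: (definable_reindex (fun u : {x : 'I_n & X} => (i, (q (tag u), tagged u))) dD).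
  + move=> v [h _] /=; apply: (eqtpP _ _ _).1 (h i _ n p q hp hq) _ dD Dc.
    by rewrite inE.
- apply: (hw (S [::]) [set w | D (concat (fun i => row w i (p i)))]).
  + by exists [::].
  + exact: (definable_reindex (fun u : {i : I & X} => (tag u, (p (tag u), tagged u))) dD).
  + by move=> v [_ h] /=; exact: (eqtpP _ _ _).1 (h p) _ dD Dc.
Qed.

(** Stretch the sequence of columns to the ordered sum of the index sets of
    the rows and keep, in each block, the entries of its own row: terms can then be
    moved within one block while the others stay fixed. *)
Lemma mutual_rows : (forall i, small K (J i)) ->
  exists c' : forall i, J i -> X -> M,
    (forall i, eqtp (A `|` range (a i)) (concat (c' i)) (concat (c (i := i)))) /\
    mutually_indiscernible A c'.
Proof.
move=> sJ; have [r [rc rp]] := infinite_rows.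
pose O : orderType _ := {i : I & J i}.
have jO : injects O K.
  apply: injects_trans (prod_injects K_nat K_lim I_small (injects_refl K)).
  by apply: tag_injects => i; exact: small_injects.
have sIX : small K (I * X) by exact: small_prod.
have [e [eA eE]] := @stretch_sequence _ _ _ mon A (I * X) _ O (fun n u => r u.1 n u.2)
  A_small sIX jO.
pose t i (j : J i) : O := Tagged J j.
pose b i (j : J i) x := e (t i j) (i, x).
have cb i : similar A (c (i := i)) (b i).
  move=> n p q hp hq; apply/eqtpP => D dD Dc.
  apply: (eE (codom (fun x => t i (q x))) _
    (definable_reindex (fun u : {x : 'I_n & X} => (t i (q (tag u)), (i, tagged u))) dD)).
  move=> s hs /=.
  apply: (eqtpP _ _ _).1 (rc i n p (fun x => s (t i (q x))) hp _) _ dD Dc => x y xy.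
  apply: hs; rewrite ?(codom_f (fun x => t i (q x))) //.
  by rewrite lt_sigma_eq hq.
have path : eqtp A (concat (fun i => b i (k i))) (concat a).
  apply/eqtp_sym/eqtpP => D dD Da.
  apply: (eE [::] _ (definable_reindex (fun u : {i : I & X} =>
    (t (tag u) (k (tag u)), (tag u, tagged u))) dD)) => s _ /=.
  exact: (eqtpP _ _ _).1 (rp (fun i => s (t i (k i)))) _ dD Da.
have mut i : indiscernible (A `|` \bigcup_(l in [set l | l <> i]) range (concat (b l))) (b i).
  pose W := ({o : O | tag o <> i} * X)%type.
  pose w (u : W) := e (sval u.1) (tag (sval u.1), u.2).
  apply: (@indiscernible_sub _ _ _ (A `|` range w)).
    move=> x [Ax|[l /= li [[j y] _ <-]]]; first by left.
    by right; exists (exist (fun o : O => tag o <> i) (t l j) li, y).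
  move=> n p q hp hq; apply: eqtp_tcat.
  pose f (p : 'I_n -> J i) (u : 'I_n + {o : O | tag o <> i}) : O :=
    match u with inl x => t i (p x) | inr o => sval o end.
  have fE x y : (f p x < f p y)%O = (f q x < f q y)%O.
    case: x y => [x|[o oi]] [y|[o' oi']] //=.
    - by rewrite !lt_sigma_eq !homo_ltE.
    - by rewrite !lt_sigma_neq //= => /esym.
    - by rewrite !lt_sigma_neq.
  pose h (u : {x : 'I_n & X} + W) : {u : 'I_n + {o : O | tag o <> i} & (I * X)%type} :=
    match u with
    | inl v => Tagged (fun=> (I * X)%type) (i := inl (tag v)) (i, tagged v)
    | inr v => Tagged (fun=> (I * X)%type) (i := inr v.1) (tag (sval v.1), v.2) end.
  have := eqtp_reindex h (similar_pattern eA fE).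
  rewrite (_ : _ \o h = tcat (concat (fun x => b i (p x))) w); last by apply: funext => -[].
  by rewrite (_ : _ \o h = tcat (concat (fun x => b i (q x))) w) //; apply: funext => -[].
have [s hs sE] := homogeneity mon A_small (small_tagp I_small X_small) path.
have sk i : s \o b i (k i) = a i.
  by apply: funext => x; exact: (congr1 (@^~ (Tagged (fun=> X) (i := i) x)) sE).
exists (fun i j => s \o b i j); split=> i.
- have e1 : eqtp A (concat (fun j => s \o b i j)) (concat (c (i := i))).
    apply/eqtp_sym; apply: eqtp_trans (similar_eqtp (cb i)) _; exact: (aut_eqtp _ hs).
  have [q hq qE] := homogeneity mon A_small (small_tagp (sJ i) X_small) e1.
  rewrite -qE; apply: aut_eqtp; apply: aut_fix => //.
  apply: funext => x; rewrite -{1}(sk i).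
  have := congr1 (@^~ (Tagged (fun=> X) (i := k i) x)) qE.
  by rewrite /concat /= ck.
- apply: indiscernible_sub (indiscernible_aut hs.1 (mut i)).
  move=> x [Ax|[l li [[j y] _ <-]]].
    by exists x; [left|exact: hs.2].
  exists (b l j y) => //; right; exists l => //.
  by exists (Tagged (fun=> X) (i := j) y).
Qed.

End Independent.

Lemma free_strictly_independent d (I : orderType d) X (a : I -> X -> M) :
  small K I -> small K X ->
  (forall i j, i <> j -> nonforking A (a i) (range (a j))) ->
  strictly_independent K A a.
Proof.
move=> sI sX afree d' J c sJ Jinf cA ca.
pose k i := projT1 (cid (ca i)).
have ck i : c i (k i) = a i by apply: funext => x; rewrite /k; case: cid.
exact: (mutual_rows sI sX afree Jinf cA ck sJ).
Qed.

(** The NIP argument of Kim's lemma: a strictly independent family is consistent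
    with rows that witness dividing, along which all paths have the same type. *)
Lemma strictly_independent_dividing (I : Type) X Z (a : I -> X -> M)
    (D : set (Z + X -> M)) (i : I) :
  infinite_set [set: I] -> small K I -> small K X -> small K Z ->
  strictly_independent K A a -> (forall j, eqtp A (a i) (a j)) ->
  definable A D -> dividing A D (a i) -> ~ exists x, forall j, D (tcat x (a j)).
Proof.
move=> Iinf sI sX sZ ind aa dD [c [cA ci ninc]] [x hx].
have hs j : exists s, aut_over A s /\ s \o c 0%N = a j.
  have [s h1 h2] := homogeneity mon A_small sX (eqtp_trans (ci 0%N) (aa j)).
  by exists s.
have [s sE] := choice hs.
pose b j n := s j \o c n.
have [|||j|r [rb rm]] := @ind _ (fun=> nat) b.
- by [].
- by move=> _; exact: infinite_nat.
- by move=> j; apply: indiscernible_aut_over cA; case: (sE j).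
- by exists 0%N => y; rewrite -(sE j).2.
have sT : small K {p : nat & X} by exact: small_tagp.
have r0 j : r j 0%N = a j.
  have [q hq qE] := homogeneity mon (smallU A_small (small_range (f := a j) sX)) sT (rb j).
  apply: funext => y; have [[bq _ _] fq] := hq; apply: (bij_inj bq).
  rewrite (fq (a j y)); last by right; exists y.
  by rewrite -(sE j).2; exact: (congr1 (@^~ (Tagged (fun=> X) (i := 0%N) y)) qE).
have bad j : exists n, ~ D (tcat x (r j n)).
  apply: contrapT => n; apply: ninc.
  apply: (@inconsistent_eqtp _ _ _ mon A A_small nat _ _ _ (r j)) => //; last first.
    by exists x => m; apply: contrapT => nD; apply: n; exists m.
  apply: (@eqtp_trans _ _ _ _ _ (concat (b j))).
    by apply: eqtp_sub (rb j) => y; left.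
  by apply/eqtp_sym; apply: (aut_eqtp (concat c)); case: (sE j).
have [k hk] := choice bad.
have rows j m n : eqtp (A `|` \bigcup_(t in [set t | t <> j]) range (concat (r t)))
   (r j m) (r j n) by apply: similar1; exact: rm.
have paths := paths_eqtp rows.
have /infiniteP/injects_setP[g gI] := Iinf.
pose h n := sval (g n).
have hI : injective h by move=> m n /sval_inj/gI.
apply: (@nip_alternation _ _ _ mon T_NIP A _ _ D x (fun n => r (h n) 0%N) (fun n => r (h n) (k (h n)))) => //.
- by move=> n; rewrite r0.
- move=> S; pose p j := if pselect (exists2 n, h n = j & ~ S n) then k j else 0%N.
  have := eqtp_reindex (fun u : {n : nat & X} => Tagged (fun=> X) (i := h (tag u)) (tagged u))
    (paths p (fun=> 0%N)).
  rewrite (_ : _ \o _ = concat (fun i => if pselect (S i) then r (h i) 0%N else r (h i) (k (h i)))) //.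
  apply: funext => -[n y]; rewrite /concat /= /p.
  case: pselect => h1; case: pselect => h2 //.
    by have [m hm nS] := h1; case: nS; rewrite (hI _ _ hm).
  by case: h1; exists n.
Qed.

(** A strict sequence in the type of the parameters of all the dividing formulas
    [E t] is strictly independent, so that each [E t] is inconsistent along it. If a
    point satisfied [D] along the sequence, then after extraction over that point the
    same [E t] would hold at every term. *)
Theorem forking_dividing X Y (D : set (X + Y -> M)) (b : Y -> M) :
  small K X -> small K Y -> definable A D ->
  forking A [set x | D (tcat x b)] -> dividing A D b.
Proof.
move=> sX sY dD fD.
have [Y1 [b1 [n [E [dE divE DE]]]]] := forking_common mon A_small sX fD.
have sY1 : small K Y1 by exact: small_finType.
have sYY : small K (Y + Y1) by exact: small_sum.
have [e [eA eb efree]] := strict_sequence mon T_NIP A_small A_base A_trivial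
  (tcat b b1) sYY.
exists (fun i => e i \o inl); split.
- exact: indiscernible_reindex.
- by move=> i; exact: (eqtp_reindex inl (eb i)).
move=> [x hx].
have sAx : small_set K (A `|` range x) by apply: smallU => //; exact: small_range.
have [e' [e'Ax e'E]] := @stretch_sequence _ _ _ mon (A `|` range x) _ _ nat e sAx sYY nat_K.
have subA : A `<=` A `|` range x by move=> y; left.
have ee' : similar A e e'.
  move=> m i j hi hj; apply/eqtpP => F dF Fi.
  have dF' := definable_reindex (fun u : {p : 'I_m & (Y + Y1)%type} => (j (tag u), tagged u)) dF.
  apply: (e'E (codom j) _ (definable_sub subA dF')) => t ht /=.
  apply: (eqtpP _ _ _).1 (eA m i (t \o j) hi _) _ dF Fi => p q pq.
  by apply: ht; rewrite ?codom_f //; apply: hj.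
have fix_x Z (f : Z -> Y + Y1) (F : set (X + Z -> M)) : definable A F ->
    definable (A `|` range x) [set y : Y + Y1 -> M | F (tcat x (y \o f))].
  move=> dF.
  pose h (u : X + Z) : (Y + Y1) + X := match u with inl x => inr x | inr z => inl (f z) end.
  rewrite [X in definable _ X](_ : _ = [set y : Y + Y1 -> M |
     [set w : (Y + Y1) + X -> M | F (w \o h)] (tcat y x)]).
    apply: definable_fix; first by move=> y; right.
    by apply: definable_reindex; exact: definable_sub dF.
  have hE (y : Y + Y1 -> M) : tcat y x \o h = tcat x (y \o f) by apply: funext => -[].
  by apply/seteqP; split=> y /=; rewrite hE.
have De' i : D (tcat x (e' i \o inl)).
  exact: (e'E [::] _ (definable_reindex (fun y => (i, y)) (fix_x _ inl D dD)) (fun t _ => hx (t i))).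
have [t Et] : exists t, E t (tcat x (e' 0%N \o inr)).
  have e0b : eqtp A (e' 0%N) (tcat b b1).
    exact: eqtp_trans (eqtp_sym (similar1 0%N 0%N ee')) (eb 0%N).
  have [s hs sE] := homogeneity mon A_small sYY e0b.
  have sb : s \o (e' 0%N \o inl) = b by apply: funext => y; exact: (congr1 (@^~ (inl y)) sE).
  have sb1 : s \o (e' 0%N \o inr) = b1 by apply: funext => y; exact: (congr1 (@^~ (inr y)) sE).
  have [|t ht] := DE (s \o x).
    by rewrite /= -sb -tcat_map (definable_aut _ hs dD).
  by exists t; move: ht; rewrite -sb1 -tcat_map (definable_aut _ hs (dE t)).
have Et' i : E t (tcat x (e' i \o inr)).
  exact: (eqtpP _ _ _).1 (similar1 0%N i e'Ax) _ (fix_x _ inr _ (dE t)) Et.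
have e'A : indiscernible A e' by exact: indiscernible_sub subA e'Ax.
have snYY : small K {p : nat & (Y + Y1)%type} by exact: small_tagp.
have e'free i j : i <> j -> nonforking A (e' i) (range (e' j)).
  move=> ij; apply: (nonforking_eqtp mon A_small sYY sYY _ (efree i j ij)).
  pose h (u : (Y + Y1) + (Y + Y1)) : {p : nat & (Y + Y1)%type} := match u with
    | inl y => Tagged (fun=> (Y + Y1)%type) (i := i) y
    | inr y => Tagged (fun=> (Y + Y1)%type) (i := j) y end.
  have := eqtp_reindex h (similar_eqtp ee').
  rewrite (_ : _ \o h = tcat (e i) (e j)); last by apply: funext => -[].
  by rewrite (_ : _ \o h = tcat (e' i) (e' j)) //; apply: funext => -[].
have ind := free_strictly_independent K_nat sYY e'free.
have div0 := dividing_longer mon A_small (f := inr) (b := tcat b b1) sX sY1 sYY (dE t) (divE t).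
have div1 := dividing_eqtp (eqtp_trans (eqtp_sym (eb 0%N)) (similar1 0%N 0%N ee')) div0.
apply: (strictly_independent_dividing infinite_nat K_nat sYY sX ind _ _ div1).
- by move=> j; apply: similar1.
- exact: definable_reindex.
exists x => i /=; have := Et' i.
rewrite (_ : tcat x (e' i) \o _ = tcat x (e' i \o inr)) //.
by apply: funext => -[].
Qed.


Lemma witness_definable (I X : Type) (a : I -> X -> M) (D : set (unit + X -> M)) i :
  witness A a -> definable A D -> dividing A D (a i) ->
  ~ exists x, forall j, D (tcat x (a j)).
Proof.
move=> wit [W [phi [e0 [eA ->]]]] [c [cA ci ninc]].
have [m [h [psi psiE]]] := parameter_support phi; pose e := e0 \o h.
have eA' : range e `<=` A by move=> _ [k _ <-]; apply: eA; exists (h k).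
have AE : A `|` range e = A by apply/seteqP; split=> x; [case=> // /eA'|left].
pose g (u : (unit + X) + 'I_m) : 'I_1 + ('I_m + X) := match u with
  | inl (inl _) => inl ord0 | inl (inr y) => inr (inr y) | inr k => inr (inl k) end.
have gE (x : 'I_1 -> M) (y : X -> M) :
    sat (tcat x (tcat e y)) (rename g psi) <-> sat (tcat (tcat (fun=> x ord0) y) e0) phi.
  rewrite sat_rename psiE.
  by rewrite (_ : _ \o g = tcat (tcat (fun=> x ord0) y) e) //; apply: funext => -[[]|].
pose sw (u : 'I_m + X) : X + 'I_m := match u with inl k => inr k | inr y => inl y end.
have swE (y : X -> M) : tcat y e \o sw = tcat e y by apply: funext => -[].
have div : divides A (rename g psi) (tcat e (a i)).
  exists (fun n => tcat (c n) e \o sw); split.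
  - by apply: indiscernible_reindex; apply: indiscernible_const; rewrite AE.
  - by move=> n; rewrite -swE; apply: eqtp_reindex; apply: tcat_eqtp; rewrite AE.
  - move=> [x hx]; apply: ninc; exists (fun=> x ord0) => n.
    by have := hx n; rewrite swE gE.
move=> [x hx]; apply: (wit i 1%N m _ e eA' div); exists (fun=> x tt) => j.
apply/gE; rewrite (_ : (fun=> x tt) = x) ; first exact: hx.
by apply: funext => -[].
Qed.

(** If [a j] forked with [a i], the formula responsible would divide, hence be
    inconsistent along the sequence. But in a sequence stretched to the lexicographic
    square of [I], it holds between a conjugate of [a j] and all the terms in the
    block of [i], which form a conjugate of the whole sequence. *)
Lemma witness_free d (I : orderType d) X (a : I -> X -> M) :
  small K I -> small K X -> infinite_set [set: I] -> indiscernible A a ->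
  witness A a -> forall i j, j <> i -> nonforking A (a j) (range (a i)).
Proof.
move=> sI sX Iinf aA wit i j ji; apply: entries => // y.
apply: (nonforkingI mon A_small); [exact: small_unit|exact: small_range|].
move=> _ /definable_split[D dD ->] Daj fD.
have div := forking_dividing (small_unit K_nat) sX dD fD.
apply: (witness_definable wit dD div).
pose O : orderType _ := {_ : I & I}; pose t (k l : I) : O := Tagged (fun=> I) (i := k) l.
have sO : small K O by exact: small_tagp.
have [b bA ab] := stretch mon A_small sX (small_injects sO) Iinf aA.
have ib : eqtp A (concat (fun k => b (t i k))) (concat a).
  apply/eqtp_sym; apply: (similar_pattern ab (F := I) (f := id) (g := t i)) => k l.
  by rewrite lt_sigma_eq.
apply: (inconsistent_eqtp mon A_small (small_tagp sI sX) dD ib).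
exists (fun=> b (t j j) y) => k.
pose h (u : unit + X) : {_ : bool & X} := match u with
  | inl _ => Tagged (fun=> X) (i := true) y | inr z => Tagged (fun=> X) (i := false) z end.
have pat (u v : bool) : ((if u then j else i) < (if v then j else i))%O =
    ((if u then t j j else t i k) < (if v then t j j else t i k))%O.
  case: u v => -[]; rewrite ?ltxx // lt_sigma_neq //.
  by move=> e; case: ji.
have := eqtp_reindex h (similar_pattern ab pat).
rewrite (_ : _ \o h = tcat (fun=> a j y) (a i)); last by apply: funext => -[].
rewrite (_ : _ \o h = tcat (fun=> b (t j j) y) (b (t i k))); last by apply: funext => -[].
by move=> e; exact: (eqtpP _ _ _).1 e _ dD Daj.
Qed.

End Strict.

(** * The four conditions *)

Theorem corollary4p8 (L : language) (T : theory L) (M : structure L) (K : Type)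
    (T_complete : complete T) (M_models : models M T) (M_monster : monster M K)
    (T_NIP : NIP M)
    (A : set M) (A_small : small_set K A)
    (A_base : extension_base K A) (A_trivial : left_totally_trivial K A)
    (d : Order.disp_t) (I : orderType d) (X : Type) (a : I -> X -> M)
    (I_small : small K I) (X_small : small K X)
    (I_infinite : infinite_set [set: I]) (a_indisc : indiscernible A a) :
  [<-> witness A a;
       forall i : I,
         nonforking A (concat (fun j : {j : I | j != i} => a (val j)))
           (range (a i));
       forall i j : I, i != j -> nonforking A (a i) (range (a j));
       strictly_independent K A a].
Proof.
have K_nat := monster_nat M_monster.
have K_lim Y := @monster_limit _ _ _ Y M_monster.
tfae.
- move=> wit i; have afree := witness_free M_monster T_NIP A_small A_base A_trivial
    I_small X_small I_infinite a_indisc wit.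
  apply: (nonforking_entries M_monster A_small A_base A_trivial) => //.
    apply: small_tagged => //; apply: small_sub I_small.
    by exists val; exact: val_inj.
  move=> [[j ij] x] /=; have ji : j <> i by exact/eqP.
  apply: (nonforking_reindex M_monster A_small (f := fun _ : unit => x)) (afree i j ji).
    exact: small_unit.
  exact: small_range.
- move=> free i j ij.
  pose f (x : X) : {k : {k : I | k != j} & X} := Tagged (fun=> X) (i := Sub i ij) x.
  apply: (nonforking_reindex M_monster A_small (f := f)) (free j) => //.
  exact: small_range.
- move=> free; apply: (free_strictly_independent M_monster A_small A_base A_trivial) => //.
  by move=> i j /eqP; exact: free.
- move=> ind i n m phi e eA [c [cA ci ninc]] [x hx].
  have AE : A `|` range e = A by apply/seteqP; split=> y; [case=> // /eA|left].
  have aa j : eqtp A (a i) (a j) by apply: similar1; exact/indiscernible_similar.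
  have ce k y : c k (inl y) = e y.
    have [s hs sE] := homogeneity M_monster A_small
      (small_sum K_nat K_lim (small_ord K_nat (n := m)) X_small) (eqtp_sym (ci k)).
    by rewrite -sE /= hs.2 //; apply: eA; exists y.
  have cE k : c k = tcat e (c k \o inr) by apply: funext => -[y|y] //=; rewrite ce.
  pose g (u : 'I_n + ('I_m + X)) : ('I_n + X) + 'I_m := match u with
    | inl k => inl (inl k) | inr (inl k) => inr k | inr (inr y) => inl (inr y) end.
  have gE (z : 'I_n -> M) (y : X -> M) :
      sat (tcat (tcat z y) e) (rename g phi) <-> sat (tcat z (tcat e y)) phi.
    rewrite sat_rename (_ : _ \o g = tcat z (tcat e y)) //.
    by apply: funext => -[|[]].
  pose D : set ('I_n + X -> M) := [set u | sat (tcat u e) (rename g phi)].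
  have dD : definable A D by exact: definable_sat.
  have div : dividing A D (a i).
    exists (fun k => c k \o inr); split.
    + exact: indiscernible_reindex.
    + by move=> k; exact: (eqtp_reindex inr (ci k)).
    + by move=> [z hz]; apply: ninc; exists z => k; rewrite cE; apply/gE; exact: hz.
  apply: (strictly_independent_dividing M_monster T_NIP A_small I_infinite I_small
    X_small (small_ord K_nat (n := n)) ind aa dD div).
  by exists x => j; apply/gE; exact: hx.
Qed.
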